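(* Assume $\mathbb{E} Y_-<\infty$ and $\mathbb{E} Y_+<\infty$. Then $$\bar\mu(\mathbf e_2)\le\min\{\mu_-(\mathbf e_2),\mu_+(\mathbf e_2)\},$$ with equality if $F_-\prec F_+$ or $F_+\prec F_-$.
   Context: Inhomogeneous first-passage percolation on $\mathbb{Z}^2$. Let $F_-$ and $F_+$ be distribution functions of probability measures supported on $[0,\infty)$. Edge weights $(\tau_e)$ on nearest-neighbour edges of $\mathbb{Z}^2$ are independent; $\tau_e\sim F_-$ if at least one endpoint of $e$ has strictly negative first coordinate, and $\tau_e\sim F_+$ otherwise. $T(u,v)$ is the infimum over nearest-neighbour paths from $u$ to $v$ of the sum of edge weights. $Y_\pm$ is the minimum of four i.i.d. $F_\pm$ variables. $\bar\mu(\mathbf e_2)$ is the almost sure limit of $T(0,n\mathbf e_2)/n$. For a distribution $F$ on $[0,\infty)$, $\mu_F(x)$ is the time constant of homogeneous first-passage percolation with i.i.d. $F$ weights, i.e. the limit in probability of $T_F(0,nx)/n$; $\mu_\pm=\mu_{F_\pm}$. $\mathbf e_2=(0,1)$. For distributions $F_1,F_2$, write $F_1\prec F_2$ ($F_1$ is more variable than $F_2$) if $\int\phi\,dF_1\le\int\phi\,dF_2$ for every concave non-decreasing $\phi:\mathbb{R}\to\mathbb{R}$ for which both integrals converge absolutely. *)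

(* Defs.v *)
From HB Require Import structures.
From mathcomp Require Import all_boot all_order all_algebra.
From mathcomp Require Import all_classical all_reals all_analysis.
Set Implicit Arguments. Unset Strict Implicit. Unset Printing Implicit Defensive.
Import Order.TTheory GRing.Theory Num.Theory.
Import numFieldNormedType.Exports.
Local Open Scope classical_set_scope.
Local Open Scope ring_scope.

Definition vertex := (int * int)%type.

(** Nearest-neighbour edges of Z^2: (v, false) = {v, v + e1}, (v, true) = {v, v + e2}.
    This is a bijective encoding of the nearest-neighbour edge set. *)
Definition edge := (vertex * bool)%type.

Definition endpoint1 (e : edge) : vertex := e.1.
Definition endpoint2 (e : edge) : vertex :=
  if e.2 then (e.1.1, e.1.2 + 1) else (e.1.1 + 1, e.1.2).

Definition nn (u v : vertex) : bool :=
  (`|u.1 - v.1| + `|u.2 - v.2| == 1)%R.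

Definition edge_of (a b : vertex) : edge :=
  if b == (a.1 + 1, a.2) then (a, false)
  else if a == (b.1 + 1, b.2) then (b, false)
  else if b == (a.1, a.2 + 1) then (a, true)
  else (b, true).

Definition path_weight {R : realType} (w : edge -> R) (u : vertex) (p : seq vertex) : R :=
  \sum_(ab <- zip (u :: p) p) w (edge_of ab.1 ab.2).

Definition passage_time {R : realType} (w : edge -> R) (u v : vertex) : R :=
  inf [set t | exists p : seq vertex,
         [/\ path nn u p, last u p = v & t = path_weight w u p]].

Definition left_edge (e : edge) : bool :=
  ((endpoint1 e).1 < 0) || ((endpoint2 e).1 < 0).

Definition supported_nonneg {R : realType} (mu : probability R R) : Prop :=
  mu `[0, +oo[%classic = 1%E.

Definition mutually_independent {R : realType} {d : measure_display}
  {T : measurableType d} (P : probability T R) {I : eqType} (X : I -> T -> R) : Prop :=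
  forall (s : seq I) (B : I -> set R), uniq s -> (forall i, measurable (B i)) ->
    fine (P (\big[setI/setT]_(i <- s) (X i @^-1` B i))) =
    \prod_(i <- s) fine (P (X i @^-1` B i)).

Definition has_law {R : realType} {d : measure_display} {T : measurableType d}
  (P : probability T R) (X : T -> R) (mu : probability R R) : Prop :=
  measurable_fun setT X /\ forall B : set R, measurable B -> P (X @^-1` B) = mu B.

Definition inhom_fpp {R : realType} {d : measure_display} {T : measurableType d}
  (P : probability T R) (tau : edge -> T -> R) (Fm Fp : probability R R) : Prop :=
  mutually_independent P tau /\
  forall e, has_law P (tau e) (if left_edge e then Fm else Fp).

Definition hom_fpp {R : realType} {d : measure_display} {T : measurableType d}
  (P : probability T R) (tau : edge -> T -> R) (F : probability R R) : Prop :=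
  mutually_independent P tau /\ forall e, has_law P (tau e) F.

Definition scale_vertex (n : nat) (x : vertex) : vertex := (x.1 *+ n, x.2 *+ n).

Definition e2 : vertex := (0, 1).

Definition cvg_in_probability {R : realType} {d : measure_display} {T : measurableType d}
  (P : probability T R) (X : nat -> T -> R) (m : R) : Prop :=
  forall eps : R, 0 < eps ->
    (fun n => P [set w | eps <= `|X n w - m| ]) @ \oo --> 0%E.

Definition time_constant_is {R : realType} (F : probability R R) (x : vertex) (m : R) : Prop :=
  forall (d : measure_display) (T : measurableType d) (P : probability T R)
         (tau : edge -> T -> R),
    hom_fpp P tau F ->
    cvg_in_probability P
      (fun n w => passage_time (fun e => tau e w) (0, 0) (scale_vertex n x) / n%:R) m.

Definition min4_finite_mean {R : realType} (F : probability R R) : Prop :=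
  (\int[(F \x F) \x (F \x F)]_z
      (Num.min (Num.min z.1.1 z.1.2) (Num.min z.2.1 z.2.2))%:E < +oo)%E.

Definition concave_fun {R : realType} (phi : R -> R) : Prop :=
  forall x y t : R, 0 <= t <= 1 ->
    t * phi x + (1 - t) * phi y <= phi (t * x + (1 - t) * y).

Definition more_variable {R : realType} (F1 F2 : probability R R) : Prop :=
  forall phi : R -> R, concave_fun phi -> {homo phi : x y / x <= y} ->
    F1.-integrable setT (EFin \o phi) -> F2.-integrable setT (EFin \o phi) ->
    (\int[F1]_x (phi x)%:E <= \int[F2]_x (phi x)%:E)%E.

(* Main.v *)
Require Import Defs.
From HB Require Import structures.
From mathcomp Require Import all_boot all_order all_algebra.
From mathcomp Require Import all_classical all_reals all_analysis.
From mathcomp Require Import measurable_realfun.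
From mathcomp Require Import ring lra zify.
Import Order.TTheory GRing.Theory Num.Theory.
Import numFieldNormedType.Exports.
Local Open Scope classical_set_scope.
Local Open Scope ring_scope.
Set Implicit Arguments. Unset Strict Implicit. Unset Printing Implicit Defensive.

(** Upper bound: take a long vertical block whose homogeneous passage time is close to
    its time constant. Finitely many paths almost realise it, hence finitely many edges
    matter, so the block can be translated horizontally into the half-plane with the right
    weights. Stacking such blocks and applying Markov's inequality bounds the speed. Bad
    blocks are controlled by four edge-disjoint detours of each unit step, whose minimum is
    at most a finite sum of minima of four independent weights, hence integrable.

    Equality: a minimum of finitely many path weights is concave and nondecreasing in every
    edge weight, so replacing the less variable weights one edge at a time by the more
    variable ones decreases its expectation, after truncation. In the limit the speed of the
    homogeneous more variable medium is at most that of the inhomogeneous one. *)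

(** * Laws of independent families *)

(** Only first moments enter: expectations add without independence between blocks, and Markov's
    inequality turns an expected time back into an event. The hypotheses, however, give events of
    probability close to 1, so a failure of small probability must also be cheap in mean. For a
    minimum over paths capped by a constant of order n this is immediate. In the upper bound the cap
    must itself be the cost of an admissible route, hence random: the cap is the detour bound, and
    uniform integrability of minima of four weights makes failures cheap. Four is the degree of a
    vertex, so four is the largest possible number of edge-disjoint detours, and it matches the
    moment assumption. All media live on the given probability space. The homogeneous ones are read
    off from edges of a single half-plane, so the hypotheses on time constants apply to them.
    Hybrids that differ in the side of one edge share every other weight at each sample point, so
    one exchange is a pointwise inequality between integrals over that single weight. *)

Section config_space.
Variables (R : realType) (I : eqType).

Definition cylinder (s : seq I) (B : I -> set R) : set (I -> R) :=
  [set x | forall i, i \in s -> B i (x i)].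

Definition cylinders : set (set (I -> R)) :=
  [set C | exists s B, (forall i, measurable (B i)) /\ C = cylinder s B].

(** The product sigma-algebra on families of reals, so that the joint law of a family is its
    pushforward to this space. *)
Definition config := g_sigma_algebraType cylinders.

Lemma setI_closed_cylinders : setI_closed cylinders.
Proof.
move=> _ _ [s [B [mB ->]]] [t [C [mC ->]]].
exists (s ++ t), (fun i => (if i \in s then B i else setT) `&` (if i \in t then C i else setT)).
split=> [i|]; first by apply: measurableI; case: ifP.
apply/seteqP; split=> [x [xs xt] i _|x xst].
  by split; case: ifP => // H; [exact: xs|exact: xt].
split=> i H; have /xst[] : i \in s ++ t by rewrite mem_cat H ?orbT.
  by rewrite H.
by rewrite H.
Qed.

Lemma measurable_eval (i : I) : measurable_fun setT (fun x : config => (x : I -> R) i).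
Proof.
move=> _ B mB; rewrite setTI; apply: sub_sigma_algebra.
exists [:: i], (fun=> B); split=> //; apply/seteqP; split=> [x Bx j|x].
  by rewrite inE => /eqP ->.
by apply; rewrite inE.
Qed.

Section families.
Context {d : measure_display} {T : measurableType d}.
Implicit Types (X : I -> T -> R) (P : probability T R).

Definition to_config X : T -> config := fun w i => X i w.

Lemma preimage_cylinder X s B :
  to_config X @^-1` cylinder s B = \big[setI/setT]_(i <- s) (X i @^-1` B i).
Proof.
elim: s => [|i s IH]; first by rewrite big_nil; apply/seteqP; split.
rewrite big_cons -IH; apply/seteqP; split=> [w Hw|w [Hi Hs] j].
  by split=> [|j js]; apply: Hw; rewrite in_cons ?eqxx// js orbT.
by rewrite in_cons => /orP[/eqP ->//|]; exact: Hs.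
Qed.

Lemma measurable_to_config X :
  (forall i, measurable_fun setT (X i)) -> measurable_fun setT (to_config X).
Proof.
move=> mX; apply: (@measurability _ _ T config setT (to_config X) cylinders) => // _ [_ [s [B [mB ->]]] <-].
rewrite setTI preimage_cylinder; apply: bigsetI_measurable => i _.
by rewrite -[X in measurable X]setTI; exact: mX.
Qed.

Lemma independent_comp (P : probability T R) X (g : I -> R -> R) :
  (forall i, measurable_fun setT (g i)) -> mutually_independent P X ->
  mutually_independent P (fun i => g i \o X i).
Proof.
move=> mg indep s B us mB.
have mB' i : measurable (g i @^-1` B i).
  by rewrite -[X in measurable X]setTI; exact: mg.
exact: (indep s (fun i => g i @^-1` B i) us mB').
Qed.

End families.

(** Cylinders form a pi-system that generates the sigma-algebra, and on a cylinder independence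
    expresses the joint law through the marginals. *)
Lemma independent_law_unique d d' (T : measurableType d) (T' : measurableType d')
  (P : probability T R) (P' : probability T' R) (X : I -> T -> R) (X' : I -> T' -> R) :
  (forall i, measurable_fun setT (X i)) -> (forall i, measurable_fun setT (X' i)) ->
  mutually_independent P X -> mutually_independent P' X' ->
  (forall i (B : set R), measurable B -> P (X i @^-1` B) = P' (X' i @^-1` B)) ->
  forall A : set config, measurable A ->
    P (to_config X @^-1` A) = P' (to_config X' @^-1` A).
Proof.
move=> mX mX' indX indX' XX' A mA.
apply: (@measure_unique _ R config cylinders (fun=> setT) _ _ _ _
  (pushforward P (to_config X))
  (pushforward P' (to_config X'))) => //.
- exact: setI_closed_cylinders.
- move=> _; exists [::], (fun=> setT); split=> //.
  by apply/seteqP; split.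
- by rewrite bigcup_const//; exists 0%N.
- exact: measurable_to_config.
- exact: measurable_to_config.
- move=> ? ? _ [s [B [mB ->]]]; rewrite /pushforward.
  (* Independence is stated for duplicate-free lists only. *)
  have -> : cylinder s B = cylinder (undup s) B.
    by apply/seteqP; split=> x Hx i Hi; apply: Hx; move: Hi; rewrite mem_undup.
  have key d0 (T0 : measurableType d0) (P0 : probability T0 R) (X0 : I -> T0 -> R) :
      (forall i, measurable_fun setT (X0 i)) -> mutually_independent P0 X0 ->
      P0 (to_config X0 @^-1` cylinder (undup s) B) =
      (\prod_(i <- undup s) fine (P0 (X0 i @^-1` B i)))%:E.
    move=> mX0 ind0; rewrite preimage_cylinder -ind0 ?undup_uniq// fineK//.
    apply: fin_num_measure; apply: bigsetI_measurable => i _.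
    by rewrite -[X in measurable X]setTI; exact: mX0.
  apply: (etrans (key _ _ P X mX indX)); apply/esym; apply: (etrans (key _ _ P' X' mX' indX')).
  by congr (_%:E); apply: eq_bigr => i _; rewrite XX'.
- move=> H1 _; apply: (@le_lt_trans _ _ (P setT)); last by rewrite probability_setT ltry.
  by rewrite [leLHS](_ : _ = P (to_config X @^-1` setT)) ?preimage_setT.
Qed.

Section expectation.
Context d d' (T : measurableType d) (T' : measurableType d').
Variables (P : probability T R) (P' : probability T' R).
Variables (X : I -> T -> R) (X' : I -> T' -> R).
Hypotheses (mX : forall i, measurable_fun setT (X i)).
Hypotheses (mX' : forall i, measurable_fun setT (X' i)).
Hypotheses (indX : mutually_independent P X) (indX' : mutually_independent P' X').

Lemma independent_expectation_unique (f : config -> R) :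
  measurable_fun setT f ->
  (forall w, 0 <= f (to_config X w)) -> (forall w, 0 <= f (to_config X' w)) ->
  (forall i (B : set R), measurable B -> P (X i @^-1` B) = P' (X' i @^-1` B)) ->
  (\int[P]_w (f (to_config X w))%:E = \int[P']_w (f (to_config X' w))%:E)%E.
Proof.
move=> mf fX fX' XX'.
(* [f] is nonnegative only along the two families, so the change of variables is made on [D], whose
   preimage is the whole space. *)
pose D : set config := [set x | 0 <= f x].
have mD : measurable D.
  rewrite -[D]setTI; apply: (mf _ [set y | 0 <= y]) => //.
  by have := @measurable_itv R `[0, +oo[; rewrite set_itvE.
have key d0 (T0 : measurableType d0) (P0 : probability T0 R) (X0 : I -> T0 -> R)
    (mX0 : measurable_fun setT (to_config X0)) :
    (forall w, 0 <= f (to_config X0 w)) ->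
    (\int[P0]_w (f (to_config X0 w))%:E =
     \int[pushforward P0 (to_config X0)]_(x in D) (f x)%:E)%E.
  move=> f0; rewrite ge0_integral_pushforward//.
  - suff -> : to_config X0 @^-1` D = setT by [].
    by apply/seteqP; split=> // w _; exact: f0.
  - by apply/measurable_EFinP; exact: measurable_funTS.
  - by move=> x; rewrite inE lee_fin.
rewrite (key _ _ P X (measurable_to_config mX))// (key _ _ P' X' (measurable_to_config mX'))//.
apply: eq_measure_integral; [exact: measurable_to_config..|move=> ? ? A mA _].
exact: independent_law_unique.
Qed.

End expectation.

(** Setting the coordinates outside [S] to 0 does not change [f] and makes all marginals agree,
    since outside [S] both become the point mass at 0. *)
Lemma independent_expectation_unique_on d d' (T : measurableType d) (T' : measurableType d')
    (P : probability T R) (P' : probability T' R) (X : I -> T -> R) (X' : I -> T' -> R)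
    (S : seq I) (f : config -> R) :
  (forall i, measurable_fun setT (X i)) -> (forall i, measurable_fun setT (X' i)) ->
  mutually_independent P X -> mutually_independent P' X' ->
  measurable_fun setT f ->
  (forall x y : I -> R, {in S, x =1 y} -> f x = f y) ->
  (forall w, 0 <= f (to_config X w)) -> (forall w, 0 <= f (to_config X' w)) ->
  (forall i, i \in S -> forall B : set R, measurable B -> P (X i @^-1` B) = P' (X' i @^-1` B)) ->
  (\int[P]_w (f (to_config X w))%:E = \int[P']_w (f (to_config X' w))%:E)%E.
Proof.
move=> mX mX' indX indX' mf fS fX fX' XX'.
pose g i (r : R) := if i \in S then r else 0.
have mg i : measurable_fun setT (g i).
  by rewrite /g; case: (i \in S); [exact: measurable_id|exact: measurable_cst].
have fg d0 (T0 : measurableType d0) (X0 : I -> T0 -> R) w :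
    f (to_config X0 w) = f (to_config (fun i => g i \o X0 i) w).
  by apply: fS => i iS; rewrite /to_config/= /g iS.
under eq_integral do rewrite fg.
under [RHS]eq_integral do rewrite fg.
apply: independent_expectation_unique => //.
- by move=> i; exact: measurableT_comp.
- by move=> i; exact: measurableT_comp.
- exact: independent_comp.
- exact: independent_comp.
- by move=> w; rewrite -fg.
- by move=> w; rewrite -fg.
- move=> i B mB; have [iS|iS] := boolP (i \in S).
    have gid : g i = id by apply/funext => r; rewrite /g iS.
    by rewrite gid; exact: XX'.
  have gcst : g i = cst 0 by apply/funext => r; rewrite /g (negbTE iS).
  rewrite gcst (_ : cst 0 \o X i = cst 0)// (_ : cst 0 \o X' i = cst 0)// !preimage_cst.
  by case: ifP => _; rewrite ?measure0 ?probability_setT.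
Qed.

(** * Replacing one coordinate by an independent copy *)

Section resampling.
Context d (T : measurableType d) (P : probability T R) (X : I -> T -> R) (i0 : I).
Hypothesis mX : forall i, measurable_fun setT (X i).
Hypothesis indX : mutually_independent P X.

Definition resample (i : I) (z : T * T) : R := if i == i0 then X i z.2 else X i z.1.

Lemma measurable_resample i : measurable_fun setT (resample i).
Proof.
by rewrite /resample; case: (i == i0); apply: measurableT_comp (mX i) _.
Qed.

Let mpre i B : measurable B -> measurable (X i @^-1` B).
Proof. by move=> mB; rewrite -[X in measurable X]setTI; exact: mX. Qed.

Lemma resample_preimage i B : resample i @^-1` B =
  if i == i0 then setT `*` (X i @^-1` B) else (X i @^-1` B) `*` setT.
Proof.
by apply/seteqP; split=> [[x y]|[x y]]; rewrite /resample/=; case: (i == i0) => //= -[].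
Qed.

Lemma resample_law i B : measurable B -> (P \x P)%E (resample i @^-1` B) = P (X i @^-1` B).
Proof.
move=> mB; rewrite resample_preimage; case: ifP => _; rewrite product_measure1E//; try exact: mpre.
  by rewrite [X in (X * _)%E]probability_setT mul1e.
by rewrite [X in (_ * X)%E]probability_setT mule1.
Qed.

(** A joint event is a rectangle: the constraint on [i0] falls on the second factor, all others on
    the first. *)
Lemma independent_resample : mutually_independent (P \x P)%E resample.
Proof.
move=> s B us mB.
pose B1 i := if i == i0 then setT else B i.
pose B2 i := if i == i0 then B i else setT.
have mB1 i : measurable (B1 i) by rewrite /B1; case: ifP.
have mB2 i : measurable (B2 i) by rewrite /B2; case: ifP.
have -> : \big[setI/setT]_(i <- s) (resample i @^-1` B i) =
    (\big[setI/setT]_(i <- s) (X i @^-1` B1 i)) `*` (\big[setI/setT]_(i <- s) (X i @^-1` B2 i)).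
  elim: (s) => [|i r IH]; first by rewrite !big_nil setXTT.
  rewrite !big_cons IH resample_preimage /B1 /B2.
  by case: ifP => _; rewrite -setXI preimage_setT ?setTI ?setIT.
transitivity (fine (P (\big[setI/setT]_(i <- s) (X i @^-1` B1 i)) *
                    P (\big[setI/setT]_(i <- s) (X i @^-1` B2 i)))%E).
  by congr fine; apply: product_measure1E; apply: bigsetI_measurable => i _; exact: mpre.
rewrite fineM; [|by apply: fin_num_measure; apply: bigsetI_measurable => i _; exact: mpre..].
rewrite indX// indX// -big_split; apply: eq_bigr => i _.
transitivity (fine (P (X i @^-1` B i))); last by congr fine; apply/esym; exact: resample_law.
rewrite /= /B1 /B2; case: ifP => _; rewrite preimage_setT probability_setT/=.
  by rewrite mul1r.
by rewrite mulr1.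
Qed.

(** Resampling preserves the joint law, and Tonelli then isolates the integral over coordinate [i0]
    with all other coordinates frozen. *)
Lemma resample_expectation (f : config -> R) : measurable_fun setT f ->
  (forall w, 0 <= f (to_config X w)) -> (forall z, 0 <= f (to_config resample z)) ->
  (\int[P]_w (f (to_config X w))%:E =
   \int[P]_w \int[P]_w' (f (fun i => if i == i0 then X i w' else X i w))%:E)%E.
Proof.
move=> mf f0 f0'.
rewrite (independent_expectation_unique mX measurable_resample indX independent_resample)//.
  rewrite (fubini_tonelli1 (fun z => (f (to_config resample z))%:E))//.
  apply/measurable_EFinP; apply: measurableT_comp => //.
  exact: measurable_to_config measurable_resample.
by move=> i B mB; apply/esym; exact: resample_law.
Qed.

End resampling.

End config_space.

(** * Paths in the square lattice *)

Definition addv (u v : vertex) : vertex := (u.1 + v.1, u.2 + v.2).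
Definition shift (v : vertex) (e : edge) : edge := (addv e.1 v, e.2).
Definition path_edges (u : vertex) (p : seq vertex) : seq edge :=
  [seq edge_of ab.1 ab.2 | ab <- zip (u :: p) p].
Definition origin : vertex := (0, 0).

Lemma addv0 u : addv u origin = u.
Proof. by case: u => a b; rewrite /addv !addr0. Qed.

Lemma add0v u : addv origin u = u.
Proof. by case: u => a b; rewrite /addv !add0r. Qed.

Lemma shift_inj v : injective (shift v).
Proof. by move=> [a b] [a' b'] [/addIr h1 /addIr h2 ->]; rewrite [a]surjective_pairing h1 h2 -surjective_pairing. Qed.

Lemma edge_of_shift v a b : edge_of (addv a v) (addv b v) = shift v (edge_of a b).
Proof.
have e (x y z : int) (y' z' : int) : ((x + z, y' + z') == (y + z, z' + y') :> vertex) = (x == y).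
  by rewrite xpair_eqE (inj_eq (addIr _)) [_ + y']addrC eqxx andbT.
case: a b v => [a1 a2] [b1 b2] [v1 v2]; rewrite /edge_of /addv/=.
rewrite !(addrAC _ _ 1) !xpair_eqE !(inj_eq (addIr _)).
by do 3 (case: ifP => // _).
Qed.

Lemma nn_shift v a b : nn (addv a v) (addv b v) = nn a b.
Proof.
case: a b v => [a1 a2] [b1 b2] [v1 v2]; rewrite /nn /addv/=.
have e (x y z : int) : x + z - (y + z) = x - y by ring.
by rewrite !e.
Qed.

Lemma path_shift v u p : path nn (addv u v) (map (addv^~ v) p) = path nn u p.
Proof. by elim: p u => //= a p IH u; rewrite nn_shift IH. Qed.

Lemma path_edges_shift v u p :
  path_edges (addv u v) (map (addv^~ v) p) = map (shift v) (path_edges u p).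
Proof. by elim: p u => //= a p IH u; rewrite /path_edges/= edge_of_shift -IH. Qed.

Lemma path_edges_cat u p q :
  path_edges u (p ++ q) = path_edges u p ++ path_edges (last u p) q.
Proof. by elim: p u => //= a p IH u; rewrite /path_edges/= -/(path_edges _ _) IH. Qed.

Lemma path_stepv (v : vertex) (c : bool) (k : nat) (s : int) : `|s| = 1 -> exists p, path nn v p /\
  last v p = addv v (if c then (0, s *+ k) else (s *+ k, 0)).
Proof.
move=> s1; elim: k => [|k [p [pp lp]]].
  by exists [::]; split => //=; case: c; rewrite mulr0n addv0.
exists (rcons p (addv v (if c then (0, s *+ k.+1) else (s *+ k.+1, 0)))).
rewrite rcons_path last_rcons pp lp; split => //=; rewrite /nn /addv.
have e1 (x : int) : x + s *+ k - (x + s *+ k.+1) = - s by rewrite mulrS; ring.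
have e2 (x : int) : x + 0 - (x + 0) = 0 by ring.
by case: c {lp pp} => /=; rewrite e1 e2 normr0 normrN s1.
Qed.

Lemma exists_path u v : exists p, path nn u p /\ last u p = v.
Proof.
have int_mul (z : int) : exists s k, `|s| = 1 /\ z = s *+ k.
  case: z => k; [exists 1, k|exists (-1), k.+1]; split => //.
    by rewrite -natz.
  by rewrite NegzE mulNrn -natz.
have [s [k [s1 sk]]] := int_mul (v.1 - u.1).
have [t [l [t1 tl]]] := int_mul (v.2 - u.2).
have [p [pp lp]] := path_stepv u false k s1.
have [q [pq lq]] := path_stepv (last u p) true l t1.
exists (p ++ q); rewrite cat_path pp pq last_cat lq lp -sk -tl; split => //.
by rewrite /addv/= !addr0 [u.1 + _]addrC [u.2 + _]addrC !subrK -surjective_pairing.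
Qed.

Section weights.
Context {R : realType}.
Implicit Types (w : edge -> R) (u v : vertex) (p : seq vertex).

Lemma path_weightE w u p : path_weight w u p = \sum_(e <- path_edges u p) w e.
Proof. by rewrite /path_weight /path_edges big_map. Qed.

Lemma path_weight_cat w u p q :
  path_weight w u (p ++ q) = path_weight w u p + path_weight w (last u p) q.
Proof. by rewrite !path_weightE path_edges_cat big_cat. Qed.

Lemma path_weight_shift w v u p :
  path_weight w (addv u v) (map (addv^~ v) p) = path_weight (w \o shift v) u p.
Proof. by rewrite !path_weightE path_edges_shift big_map. Qed.

Lemma path_weight_ge0 w u p : (forall e, 0 <= w e) -> 0 <= path_weight w u p.
Proof. by move=> w0; rewrite path_weightE; apply: sumr_ge0. Qed.

Section nonneg.
Variable w : edge -> R.
Hypothesis w0 : forall e, 0 <= w e.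

Lemma passage_time_le u p : path nn u p -> passage_time w u (last u p) <= path_weight w u p.
Proof.
move=> pp; apply: ge_inf; last by exists p.
by exists 0 => _ [q [_ _ ->]]; exact: path_weight_ge0.
Qed.

Lemma passage_time_ge c u v :
  (forall p, path nn u p -> last u p = v -> c <= path_weight w u p) -> c <= passage_time w u v.
Proof.
move=> H; apply: lb_le_inf.
  by have [p [pp lp]] := exists_path u v; exists (path_weight w u p), p.
by move=> _ [p [pp lp ->]]; exact: H.
Qed.

Lemma passage_time_lt c u v : passage_time w u v < c ->
  exists p, [/\ path nn u p, last u p = v & path_weight w u p < c].
Proof.
move=> H; apply: contrapT => nex; move: H; apply/negP; rewrite -leNgt.
apply: passage_time_ge => p pp lp; rewrite leNgt; apply/negP => H.
by apply: nex; exists p.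
Qed.

Lemma passage_time_ge0 u v : 0 <= passage_time w u v.
Proof. by apply: passage_time_ge => p _ _; exact: path_weight_ge0. Qed.

Lemma passage_time_triangle u v z :
  passage_time w u z <= passage_time w u v + passage_time w v z.
Proof.
rewrite -lerBlDr; apply: passage_time_ge => p pp lp; rewrite lerBlDr addrC -lerBlDr.
apply: passage_time_ge => q pq lq; rewrite lerBlDr addrC -lp -path_weight_cat -lq -lp.
by rewrite -last_cat passage_time_le// cat_path pp lp.
Qed.

Lemma passage_time_refl u : passage_time w u u = 0.
Proof.
apply/le_anti; rewrite passage_time_ge0 andbT.
by have := @passage_time_le u [::] isT; rewrite path_weightE big_nil.
Qed.

Lemma passage_time_shift u v z :
  passage_time w (addv u z) (addv v z) <= passage_time (w \o shift z) u v.
Proof.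
rewrite [leRHS]/passage_time; apply: lb_le_inf.
  by have [p [pp lp]] := exists_path u v; exists (path_weight (w \o shift z) u p), p.
move=> _ [p [pp <- ->]]; rewrite -path_weight_shift.
have -> : addv (last u p) z = last (addv u z) (map (addv^~ z) p) by rewrite (last_map (addv^~ z)).
by apply: passage_time_le; rewrite path_shift.
Qed.

Lemma passage_time_concat (u : nat -> vertex) n :
  passage_time w (u 0%N) (u n) <= \sum_(i < n) passage_time w (u i) (u i.+1).
Proof.
elim: n => [|n IH]; first by rewrite passage_time_refl big_ord0.
rewrite big_ord_recr/=; apply: le_trans (passage_time_triangle _ (u n) _) _.
by rewrite lerD2r.
Qed.

End nonneg.

(* four edge-disjoint paths from the origin to (0,1) *)
Definition detour1 : seq vertex := [:: (0, 1)].
Definition detour2 : seq vertex := [:: (1, 0); (1, 1); (0, 1)].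
Definition detour3 : seq vertex := [:: (-1, 0); (-1, 1); (0, 1)].
Definition detour4 : seq vertex :=
  [:: (0, -1); (1, -1); (2, -1); (2, 0); (2, 1); (2, 2); (1, 2); (0, 2); (0, 1)].

(** Nested as the product measure in [min4_finite_mean]. *)
Definition quad := ((edge * edge) * (edge * edge))%type.

Definition quads : seq quad := [seq (a, b) |
  a <- [seq (x, y) | x <- path_edges origin detour1, y <- path_edges origin detour2],
  b <- [seq (x, y) | x <- path_edges origin detour3, y <- path_edges origin detour4]].

Definition min4 w (q : quad) : R :=
  Num.min (Num.min (w q.1.1) (w q.1.2)) (Num.min (w q.2.1) (w q.2.2)).

Lemma min4_ge0 w q : (forall e, 0 <= w e) -> 0 <= min4 w q.
Proof. by move=> w0; rewrite /min4 !le_min !w0. Qed.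

(** Disjointness of the detours, decided by computation on the 1 * 3 * 3 * 9 = 81 quadruples. It
    makes the four weights independent. *)
Lemma quads_uniq q : q \in quads -> uniq [:: q.1.1; q.1.2; q.2.1; q.2.2].
Proof.
suff /allP : all (fun q : quad => uniq [:: q.1.1; q.1.2; q.2.1; q.2.2]) quads by apply.
by vm_compute.
Qed.

(** Subadditivity of truncation at level [c] on nonnegative numbers. *)
Lemma min_sum_le (I : Type) (s : seq I) (f : I -> R) (c : R) : (forall i, 0 <= f i) -> 0 <= c ->
  Num.min (\sum_(i <- s) f i) c <= \sum_(i <- s) Num.min (f i) c.
Proof.
move=> f0 c0; elim: s => [|i s IH]; first by rewrite !big_nil ge_min lexx.
rewrite !big_cons; apply: le_trans (_ : Num.min (f i) c + Num.min (\sum_(j <- s) f j) c <= _).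
  have := f0 i; have : 0 <= \sum_(j <- s) f j by apply: sumr_ge0.
  by rewrite !minEle; do 3 (case: ifP => ?); lra.
by rewrite lerD2l.
Qed.

Lemma min_sum2_le (I J : Type) (s : seq I) (t : seq J) (f : I -> R) (g : J -> R) :
  (forall i, 0 <= f i) -> (forall j, 0 <= g j) ->
  Num.min (\sum_(i <- s) f i) (\sum_(j <- t) g j) <=
  \sum_(ij <- [seq (i, j) | i <- s, j <- t]) Num.min (f ij.1) (g ij.2).
Proof.
move=> f0 g0; rewrite big_allpairs/=; apply: le_trans (min_sum_le _ f0 _) _.
  exact: sumr_ge0.
apply: ler_sum => i _; rewrite minC; apply: le_trans (min_sum_le _ g0 _) _ => //.
by apply: ler_sum => j _; rewrite minC.
Qed.

(** The minimum of four path sums is at most the sum, over all choices of one edge per detour, of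
    the minimum of the chosen weights. Only minima of four weights have a finite mean, not single
    weights. *)
Lemma passage_time_e2_le w : (forall e, 0 <= w e) ->
  passage_time w origin e2 <= \sum_(q <- quads) min4 w q.
Proof.
move=> w0; set S := fun p => path_weight w origin p.
apply: (@le_trans _ _ (Num.min (Num.min (S detour1) (S detour2)) (Num.min (S detour3) (S detour4)))).
  rewrite !le_min.
  have H p : path nn origin p -> last origin p = e2 -> passage_time w origin e2 <= S p.
    by move=> pp <-; exact: passage_time_le.
  by apply/andP; split; apply/andP; split; apply: H.
rewrite /S !path_weightE.
have m0 q1 : 0 <= Num.min (w (q1 : edge * edge).1) (w q1.2) by rewrite le_min !w0.
have min_mono (a a' b b' : R) : a <= a' -> b <= b' -> Num.min a b <= Num.min a' b'.
  by move=> aa' bb'; rewrite le_min !ge_min aa' bb' orbT.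
apply: le_trans (min_mono _ _ _ _ (min_sum2_le _ _ w0 w0) (min_sum2_le _ _ w0 w0)) _.
exact: (min_sum2_le _ _ m0 m0).
Qed.

(** The detour bound summed over the [K] unit steps of a vertical segment. It depends on finitely
    many edges and serves as the random cap on the time of a block. *)
Definition bridge w (K : nat) : R :=
  \sum_(i < K) \sum_(q <- quads) min4 (w \o shift (0, i%:Z)) q.

Lemma passage_time_bridge w K : (forall e, 0 <= w e) ->
  passage_time w origin (0, K%:Z) <= bridge w K.
Proof.
move=> w0; apply: le_trans (passage_time_concat w0 (fun i => (0, i%:Z)) K) _.
apply: ler_sum => i _.
have -> : (0, (i.+1)%:Z) = addv e2 (0, i%:Z) by rewrite /addv/= addr0 intS.
have -> : (0, i%:Z) = addv origin (0, i%:Z) :> vertex by rewrite add0v.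
apply: le_trans (passage_time_shift w0 _ _ _) _.
by apply: passage_time_e2_le => e; exact: w0.
Qed.

Lemma bridge_ge0 w K : (forall e, 0 <= w e) -> 0 <= bridge w K.
Proof. by move=> w0; apply: sumr_ge0 => i _; apply: sumr_ge0 => q _; apply: min4_ge0 => e; exact: w0. Qed.

(** The seed [L] is a cap: a constant truncation in the comparison of media, the random [bridge] in
    the upper bound. *)
Definition min_weight (L : R) (s : seq (seq vertex)) w : R :=
  \big[Num.min/L]_(p <- s) path_weight w origin p.

Lemma min_weight_geP c L s w :
  c <= min_weight L s w <-> c <= L /\ forall p, p \in s -> c <= path_weight w origin p.
Proof.
rewrite /min_weight; elim: s => [|p s IH].
  by rewrite big_nil; split=> [|[]].
rewrite big_cons le_min; split=> [/andP[cp /IH[cL H]]|[cL H]].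
  by split=> // q; rewrite in_cons => /orP[/eqP ->//|]; exact: H.
rewrite H ?mem_head//=; apply/IH; split=> // q qs; apply: H.
by rewrite in_cons qs orbT.
Qed.

Lemma min_weight_le L s w p : p \in s -> min_weight L s w <= path_weight w origin p.
Proof. by move=> ps; have [_ H] := (min_weight_geP _ L s w).1 (lexx _); exact: H. Qed.

Lemma min_weight_leL L s w : min_weight L s w <= L.
Proof. by have [] := (min_weight_geP _ L s w).1 (lexx _). Qed.

Lemma min_weight_ge0 L s w : 0 <= L -> (forall e, 0 <= w e) -> 0 <= min_weight L s w.
Proof. by move=> L0 w0; apply/min_weight_geP; split=> // p _; exact: path_weight_ge0. Qed.

Lemma eq_path_weight w w' u p :
  {in path_edges u p, w =1 w'} -> path_weight w u p = path_weight w' u p.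
Proof. by move=> ww'; rewrite !path_weightE; apply: eq_big_seq. Qed.

Lemma eq_min_weight L s w w' : {in flatten (map (path_edges origin) s), w =1 w'} ->
  min_weight L s w = min_weight L s w'.
Proof.
move=> ww'; rewrite /min_weight; apply: eq_big_seq => p ps.
by apply: eq_path_weight => e ep; apply: ww'; apply/flatten_mapP; exists p.
Qed.

Definition bridge_edges (K : nat) : seq edge :=
  flatten [seq flatten [seq map (shift (0, i%:Z)) [:: q.1.1; q.1.2; q.2.1; q.2.2] | q <- quads]
          | i <- iota 0 K].

Lemma eq_bridge K w w' : {in bridge_edges K, w =1 w'} -> bridge w K = bridge w' K.
Proof.
move=> ww'; apply: eq_bigr => i _; apply: eq_big_seq => q qq.
have H e : e \in [:: q.1.1; q.1.2; q.2.1; q.2.2] -> w (shift (0, i%:Z) e) = w' (shift (0, i%:Z) e).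
  move=> eq; apply: ww'; apply/flatten_mapP; exists (i : nat); first by rewrite mem_iota/=.
  by apply/flatten_mapP; exists q => //; exact: map_f.
by rewrite /min4 /comp !H// !inE eqxx ?orbT.
Qed.

Definition update w (e0 : edge) (y : R) : edge -> R := fun e => if e == e0 then y else w e.

(** Path weights are affine in each single edge weight; the slope counts the crossings of the edge,
    hence is nonnegative. This is the source of monotonicity and concavity of [min_weight]. *)
Lemma path_weight_update w e0 y u p : path_weight (update w e0 y) u p =
  path_weight (update w e0 0) u p + y *+ count_mem e0 (path_edges u p).
Proof.
rewrite !path_weightE; elim: (path_edges u p) => [|e s IH]; first by rewrite !big_nil addr0.
rewrite !big_cons IH /update /=; case: eqVneq => _; last by rewrite addrA.
by rewrite mulrnDr mulr1n add0r; ring.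
Qed.

Lemma homo_min_weight L s w e0 :
  {homo (fun y => min_weight L s (update w e0 y)) : x y / x <= y}.
Proof.
move=> x y xy; apply/min_weight_geP; split=> [|p ps]; first exact: min_weight_leL.
apply: le_trans (min_weight_le _ _ ps) _.
by rewrite path_weight_update [leRHS]path_weight_update lerD2l lerMn2r xy orbT.
Qed.

Lemma concave_min_weight L s w e0 :
  concave_fun (fun y => min_weight L s (update w e0 y)).
Proof.
move=> x y t /andP[t0 t1]; have t1' : 0 <= 1 - t by rewrite subr_ge0.
apply/min_weight_geP; split=> [|p ps].
  rewrite [leRHS](_ : L = t * L + (1 - t) * L); last by ring.
  by apply: lerD; apply: ler_wpM2l => //; exact: min_weight_leL.
apply: le_trans (_ : t * path_weight (update w e0 x) origin p +
   (1 - t) * path_weight (update w e0 y) origin p <= _).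
  by apply: lerD; apply: ler_wpM2l => //; exact: min_weight_le.
rewrite path_weight_update [X in _ + _ * X]path_weight_update [leRHS]path_weight_update.
rewrite le_eqVlt; apply/orP; left; apply/eqP.
move: (path_weight _ _ _) (count_mem _ _) => A n.
by rewrite -(mulr_natr x) -(mulr_natr y) -(mulr_natr (_ + _)); ring.
Qed.

End weights.

(** * Edges and the two half-planes *)

Lemma left_edgeE e : left_edge e = (e.1.1 < 0).
Proof.
rewrite /left_edge /endpoint1 /endpoint2; case: e => [[a b] [|]]/=; first by rewrite orbb.
by apply/orP/idP => [[//|]|->]; [|by left]; lia.
Qed.

(** A horizontal shift beyond the width of the finite set suffices. The side of an edge ignores its
    height, so one [c] serves blocks at all heights. *)
Lemma exists_half_plane_shift (S : seq edge) (b : bool) :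
  exists c : int, forall e, e \in S -> forall m : int, left_edge (shift (c, m) e) = b.
Proof.
pose B : int := 1 + \sum_(e <- S) `|e.1.1|.
have HB e : e \in S -> `|e.1.1| < B.
  move=> eS; rewrite /B (big_rem e eS)/=.
  have : 0 <= \sum_(y <- rem e S) `|y.1.1| by apply: sumr_ge0.
  by rewrite addrCA ltrDl => z0; rewrite ltr_wpDr.
exists (if b then - B else B) => e /HB; rewrite ltr_norml => /andP[eB1 eB2] m.
rewrite left_edgeE /shift /addv/=; case: b => /=; first by rewrite subr_lt0.
by apply/negbTE; rewrite -leNgt -lerBlDr sub0r ltW.
Qed.

(** Places [e] on the vertical edge at height 0 in the column numbered by its code, mirrored to a
    negative column for the left side. Codes make it injective even when the side varies with the
    edge. *)
Definition edge_on_side (e : edge) (b : bool) : edge :=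
  ((if b then Negz (pickle e) else Posz (pickle e), 0), true).

Lemma left_edge_on_side e b : left_edge (edge_on_side e b) = b.
Proof. by rewrite left_edgeE; case: b. Qed.

Lemma edge_on_side_inj e e' b b' : edge_on_side e b = edge_on_side e' b' -> e = e'.
Proof. by case: b; case: b' => -[] // /(pcan_inj pickleK). Qed.

(** * Measurability and integration *)

Section measurability.
Context {R : realType}.
Local Notation config := (config R edge).

Lemma measurable_path_weight u p :
  measurable_fun setT (fun x : config => path_weight x u p).
Proof.
rewrite (_ : (fun x => _) = fun x : config => \sum_(e <- path_edges u p) (x : edge -> R) e).
  by apply: measurable_sum => e; exact: measurable_eval.
by apply/funext => x; exact: path_weightE.
Qed.

Lemma measurable_min_weight (L : config -> R) s : measurable_fun setT L ->
  measurable_fun setT (fun x : config => min_weight (L x) s x).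
Proof.
move=> mL; rewrite /min_weight; elim: s => [|p s IH].
  by rewrite (_ : (fun x => _) = L)//; apply/funext => x; rewrite big_nil.
rewrite (_ : (fun x => _) = fun x : config =>
  Num.min (path_weight x origin p) (\big[Num.min/L x]_(p <- s) path_weight x origin p)).
  by apply: measurable_minr => //; exact: measurable_path_weight.
by apply/funext => x; rewrite big_cons.
Qed.

Lemma measurable_min4 (q : quad) : measurable_fun setT (fun x : config => min4 x q).
Proof. by do 2 (apply: measurable_minr => //); exact: measurable_eval. Qed.

Lemma measurable_shift v : measurable_fun setT ((fun x => x \o shift v) : config -> config).
Proof.
exact: (measurable_to_config (X := fun e (x : config) => (x : edge -> R) (shift v e)) (fun e => measurable_eval _)).
Qed.

Lemma measurable_bridge K : measurable_fun setT (fun x : config => bridge x K).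
Proof.
apply: measurable_sum => i; apply: measurable_sum => q.
exact: measurableT_comp (measurable_min4 q) (measurable_shift (0, (i : nat)%:Z)).
Qed.

Lemma measurable_update (x : edge -> R) e0 : measurable_fun setT (update x e0 : R -> config).
Proof.
apply: (measurable_to_config (X := fun e y => update x e0 y e)) => e.
by rewrite /update; case: eqP => _; [exact: measurable_id|exact: measurable_cst].
Qed.

End measurability.

Section probability_lemmas.
Context {R : realType} {d : measure_display} {T : measurableType d}.
Variable P : probability T R.

Lemma measurable_fun_lt (f : T -> R) c : measurable_fun setT f -> measurable [set w | f w < c].
Proof.
move=> mf; rewrite (_ : [set _ | _] = setT `&` f @^-1` `]-oo, c[%classic).
  exact: mf.
by rewrite setTI set_itvE; apply/seteqP; split.
Qed.

(** Continuity from below along the increasing events on which [A n] holds for every n from [m]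
    on. *)
Lemma ae_eventually (A : nat -> set T) : (forall n, measurable (A n)) ->
  (\forall w \ae P, \forall n \near \oo, A n w) ->
  forall delta : R, 0 < delta -> exists n0, forall n, (n0 <= n)%N -> ((1 - delta)%:E < P (A n))%E.
Proof.
move=> mA aeA delta d0.
pose E m := \bigcap_(n in [set n | (m <= n)%N]) A n.
have mE m : measurable (E m) by apply: bigcap_measurable => //; exists m => /=.
have mU : measurable (\bigcup_m E m) by apply: bigcup_measurable => m _.
have PU : P (\bigcup_m E m) = 1%E.
  have [N [mN PN0 NE]] := aeA.
  have PC0 : P (~` \bigcup_m E m) = 0%E.
    apply/eqP; rewrite -measure_le0 -PN0; apply: le_measure; rewrite ?inE//.
    exact: measurableC.
  by rewrite -(setCK (\bigcup_m E m)) probability_setC ?PC0 ?sube0//; exact: measurableC.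
have cvgE : P \o E @ \oo --> P (\bigcup_m E m).
  apply: nondecreasing_cvg_mu => // m n mn; apply/subsetPset => w Ew k /= nk.
  by apply: Ew => /=; exact: leq_trans nk.
rewrite PU in cvgE.
have /cvgE [n0 _ Hn0] : nbhs 1%E (fun x : \bar R => (1 - delta)%:E < x)%E.
  by apply: (@nbhs_open_ereal_gt R 1 (fun=> 1 - delta)); lra.
exists n0 => n nn0; apply: (lt_le_trans (Hn0 n nn0)).
by apply: le_measure; rewrite ?inE// => w Ew; apply: Ew => /=.
Qed.

Lemma integral_le_split (f : T -> R) (G : set T) c1 c2 : measurable_fun setT f -> measurable G ->
  0 <= c1 -> 0 <= c2 -> (forall w, 0 <= f w) -> (forall w, G w -> f w <= c1) ->
  (forall w, f w <= c2) ->
  (\int[P]_w (f w)%:E <= c1%:E + c2%:E * P (~` G))%E.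
Proof.
move=> mf mG c10 c20 f0 fG fc.
have mGC := measurableC mG.
have -> : (c1%:E + c2%:E * P (~` G) = \int[P]_w (c1 + c2 * \1_(~` G) w)%:E)%E.
  under eq_integral do rewrite EFinD EFinM.
  rewrite ge0_integralD//.
  - rewrite integral_cst// [X in (_ * X + _)%E]probability_setT mule1 ge0_integralZl//.
    + by rewrite integral_indic// setIT.
    + by apply/measurable_EFinP; exact: measurable_indic.
  - by move=> w _; rewrite -EFinM lee_fin mulr_ge0.
  - by apply/measurable_EFinP; apply: measurable_funM => //; exact: measurable_indic.
apply: ge0_le_integral => //.
- by move=> w _; rewrite lee_fin.
- exact/measurable_EFinP.
- apply/measurable_EFinP; apply: measurable_funD => //.
  by apply: measurable_funM => //; exact: measurable_indic.
- move=> w _; rewrite lee_fin indicE.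
  have [wG|wG] := boolP (w \in ~` G); first by rewrite mulr1; apply: le_trans (fc w) _; rewrite lerDr.
  rewrite mulr0 addr0; apply: fG; apply: contrapT => nG.
  by move/negP: wG; apply; rewrite inE.
Qed.

Lemma markov_le (f : T -> R) (G : set T) c : measurable_fun setT f -> measurable G ->
  0 <= c -> (forall w, 0 <= f w) -> (forall w, G w -> c <= f w) ->
  (c%:E * P G <= \int[P]_w (f w)%:E)%E.
Proof.
move=> mf mG c0 f0 fG.
have -> : (c%:E * P G = \int[P]_w (c * \1_G w)%:E)%E.
  under eq_integral do rewrite EFinM.
  rewrite ge0_integralZl//.
  - by rewrite integral_indic// setIT.
  - by apply/measurable_EFinP; exact: measurable_indic.
apply: ge0_le_integral => //.
- by move=> w _; rewrite lee_fin mulr_ge0.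
- by apply/measurable_EFinP; apply: measurable_funM => //; exact: measurable_indic.
- exact/measurable_EFinP.
- move=> w _; rewrite lee_fin indicE.
  have [wG|wG] := boolP (w \in G); last by rewrite mulr0.
  by rewrite mulr1; apply: fG; rewrite inE in wG.
Qed.

(** The bounds on [phi] are required along [X] only: a minimum of path weights is nonnegative only
    where the weights are. *)
Lemma integral_law (F : probability R R) (X : T -> R) (phi : R -> R) (L : R) :
  measurable_fun setT X -> (forall B : set R, measurable B -> P (X @^-1` B) = F B) ->
  measurable_fun setT phi -> (forall w, 0 <= phi (X w) <= L) ->
  F.-integrable setT (EFin \o phi) /\
  (\int[P]_w (phi (X w))%:E = \int[F]_x (phi x)%:E)%E.
Proof.
move=> mX lawX mphi phiX.
have intX : P.-integrable (X @^-1` setT) (EFin \o phi \o X).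
  rewrite preimage_setT.
  apply: (@measurable_bounded_integrable _ _ _ P (phi \o X) setT) => //.
  - exact: le_lt_trans (probability_le1 P measurableT) (ltry _).
  - exact: measurableT_comp.
  - exists L; split; first exact: num_real.
    move=> M LM w _ /=; have /andP[p0 pL] := phiX w.
    by rewrite ger0_norm//; apply: le_trans pL (ltW LM).
have mphi' : measurable_fun setT (EFin \o phi) by exact/measurable_EFinP.
have eqF (g : R -> \bar R) : (\int[pushforward P X]_x g x = \int[F]_x g x)%E.
  by apply: eq_measure_integral => A mA _; exact: lawX.
split; last first.
  rewrite -eqF; apply/esym.
  by rewrite -[LHS]/(\int[pushforward P X]_x ((EFin \o phi) x))%E (integral_pushforward mX mphi' intX) ?preimage_setT.
have /integrableP[_ h] := integrable_pushforward mX mphi' intX measurableT.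
by apply/integrableP; split=> //; rewrite -eqF.
Qed.

End probability_lemmas.

(** * Exchanging edge weights *)

Lemma independent_reindex {R : realType} {d} {T : measurableType d} (P : probability T R)
  (I J : eqType) (X : I -> T -> R) (f : J -> I) : injective f ->
  mutually_independent P X -> mutually_independent P (fun j => X (f j)).
Proof.
move=> inj_f indX s B us mB.
(* Transports [B] along [f]: it is [B j] at [f j] and the full set off the range. *)
pose B' i : set R := [set r | forall j, f j = i -> B j r].
have B'f j : B' (f j) = B j.
  by apply/seteqP; split=> [r|r Br k /inj_f ->//]; apply.
have mB' i : measurable (B' i).
  have [[j <-]|nj] := pselect (exists j, f j = i); first by rewrite B'f.
  by rewrite (_ : B' i = setT)//; apply/seteqP; split=> // r _ j fji; case: nj; exists j.
have := indX (map f s) B'; rewrite map_inj_uniq// !big_map => /(_ us mB').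
by under eq_bigr do rewrite B'f; under [X in _ = X -> _]eq_bigr do rewrite B'f.
Qed.

Section model.
Context {R : realType} {d : measure_display} {T : measurableType d}.
Variables (P : probability T R) (F : bool -> probability R R) (X : edge -> T -> R).
Hypothesis mX : forall e, measurable_fun setT (X e).
Hypothesis X0 : forall e w, 0 <= X e w.
Hypothesis indX : mutually_independent P X.
Hypothesis lawX : forall e (B : set R), measurable B -> P (X e @^-1` B) = F (left_edge e) B.
Local Notation config := (config R edge).

Lemma measurable_model (f : config -> R) (Y : edge -> T -> R) :
  (forall e, measurable_fun setT (Y e)) -> measurable_fun setT f ->
  measurable_fun setT (fun w => f (to_config Y w)).
Proof. by move=> mY mf; apply: measurableT_comp mf (measurable_to_config mY). Qed.

(* Since X has infinitely many edges of either side, every assignment of sides is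
   realised by an independent family on the same probability space. *)
Definition sided (t : edge -> bool) (e : edge) : T -> R := X (edge_on_side e (t e)).

Lemma sided_law t e (B : set R) : measurable B -> P (sided t e @^-1` B) = F (t e) B.
Proof. by move=> mB; rewrite lawX// left_edge_on_side. Qed.

Lemma independent_sided t : mutually_independent P (sided t).
Proof. by apply: (independent_reindex _ indX) => e e' /edge_on_side_inj. Qed.

Lemma measurable_sided t e : measurable_fun setT (sided t e).
Proof. exact: mX. Qed.

Lemma sided_ge0 t e w : 0 <= sided t e w.
Proof. exact: X0. Qed.

(** [sided left_edge] is a different family from [X] but has the same joint law, which brings the
    exchange argument back to the given medium. *)
Lemma sided_left_edge_expectation (f : config -> R) : measurable_fun setT f ->
  (forall x : edge -> R, (forall e, 0 <= x e) -> 0 <= f x) ->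
  (\int[P]_w (f (to_config (sided left_edge) w))%:E = \int[P]_w (f (to_config X w))%:E)%E.
Proof.
move=> mf f0; apply: independent_expectation_unique => //.
- exact: measurable_sided.
- exact: independent_sided.
- by move=> w; apply: f0 => e; exact: X0.
- by move=> w; apply: f0 => e; exact: X0.
- by move=> e B mB; rewrite sided_law// lawX.
Qed.

Section exchange.
Variables (b : bool) (L : R) (s : seq (seq vertex)).
Hypothesis L0 : 0 <= L.
Hypothesis Fb : more_variable (F b) (F (~~ b)).

Let f (x : config) : R := min_weight L s x.

Let mf : measurable_fun setT f.
Proof. exact: measurable_min_weight. Qed.

Let f0 (x : edge -> R) : (forall e, 0 <= x e) -> 0 <= f x.
Proof. exact: min_weight_ge0. Qed.

(** The weight of [e0] is integrated first, against its own law. Measurability and integrability are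
    stated alongside because the outer integrals are compared by monotonicity, the inner ones
    through [more_variable]. *)
Lemma sided_expectation_update t e0 :
  (\int[P]_w (f (to_config (sided t) w))%:E =
   \int[P]_w \int[F (t e0)]_y (f (update (to_config (sided t) w) e0 y))%:E)%E /\
  measurable_fun setT (fun w => \int[F (t e0)]_y (f (update (to_config (sided t) w) e0 y))%:E)%E /\
  forall w, (F (t e0)).-integrable setT (EFin \o (fun y => f (update (to_config (sided t) w) e0 y))) /\
    (0 <= \int[F (t e0)]_y (f (update (to_config (sided t) w) e0 y))%:E)%E.
Proof.
(* The truncation at [L] bounds [f]; this provides the integrability demanded by [more_variable]. *)
have inner w : (F (t e0)).-integrable setT (EFin \o (fun y => f (update (to_config (sided t) w) e0 y))) /\
    (\int[P]_w' (f (update (to_config (sided t) w) e0 (sided t e0 w')))%:E =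
     \int[F (t e0)]_y (f (update (to_config (sided t) w) e0 y))%:E)%E.
  apply: (@integral_law _ _ _ P (F (t e0)) (sided t e0) (fun y => f (update (to_config (sided t) w) e0 y)) L).
  - exact: measurable_sided.
  - by move=> B mB; rewrite sided_law.
  - exact: measurableT_comp mf (measurable_update _ _).
  - move=> w'; rewrite min_weight_leL andbT; apply: f0 => e.
    by rewrite /update; case: eqP => _; exact: sided_ge0.
have E w : (\int[F (t e0)]_y (f (update (to_config (sided t) w) e0 y))%:E =
     \int[P]_w' (f (to_config (resample (sided t) e0) (w, w')))%:E)%E.
  rewrite -(inner w).2; apply: eq_integral => w' _; congr (_%:E); congr f.
  by apply/funext => e; rewrite /update /to_config /resample/=; case: eqP => [->|].
split; [|split].
- rewrite (resample_expectation (i0 := e0) (measurable_sided t) (independent_sided t) mf).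
  + by apply: eq_integral => w _; rewrite E.
  + by move=> w; apply: f0 => e; exact: sided_ge0.
  + by move=> z; apply: f0 => e; rewrite /to_config /resample; case: eqP => _; exact: sided_ge0.
- rewrite (_ : (fun w => _) = fubini_F P (fun z => (f (to_config (resample (sided t) e0) z))%:E)).
    apply: measurable_fun_fubini_tonelli_F.
      apply/measurable_EFinP; apply: measurableT_comp mf _.
      exact: measurable_to_config (measurable_resample e0 (measurable_sided t)).
    move=> z; rewrite lee_fin; apply: f0 => e.
    by rewrite /to_config /resample; case: eqP => _; exact: sided_ge0.
  by apply/funext => w; rewrite E.
- move=> w; split; first by have [] := inner w.
  rewrite E; apply: integral_ge0 => w' _; rewrite lee_fin; apply: f0 => e.
  by rewrite /to_config /resample; case: eqP => _; exact: sided_ge0.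
Qed.

(** For each sample point both inner integrands are the same concave nondecreasing function of the
    weight of [e0], integrated against [F b] and [F (~~ b)] respectively. *)
Lemma exchange_one t t' e0 : (forall e, e != e0 -> t e = t' e) -> t' e0 = b ->
  (\int[P]_w (f (to_config (sided t') w))%:E <= \int[P]_w (f (to_config (sided t) w))%:E)%E.
Proof.
move=> tt' t'e0; have [te0|te0] := eqVneq (t e0) b.
  rewrite (_ : t' = t)//; apply/funext => e; have [->|/tt' ->//] := eqVneq e e0.
  by rewrite t'e0.
have {}te0 : t e0 = ~~ b by case: (t e0) (b) te0 => -[].
have [-> [m1 i1]] := sided_expectation_update t e0.
have [-> [m2 i2]] := sided_expectation_update t' e0.
have upd w y : update (to_config (sided t') w) e0 y = update (to_config (sided t) w) e0 y.
  apply/funext => e; rewrite /update /to_config /sided; have [//|/tt' ->//] := eqVneq e e0.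
apply: ge0_le_integral => //.
- by move=> w _; exact: (i2 w).2.
- move=> w _; have upd' : (fun y => f (update (to_config (sided t') w) e0 y)) =
    (fun y => f (update (to_config (sided t) w) e0 y)) by apply/funext => y; rewrite upd.
  under eq_integral do rewrite upd.
  have [i2w _] := i2 w; have [i1w _] := i1 w; rewrite upd' t'e0 in i2w; rewrite te0 in i1w.
  rewrite t'e0 te0; apply: Fb => //.
  + exact: concave_min_weight.
  + exact: homo_min_weight.
Qed.

(** Induction on the list of edges already switched to side [b]. Once it contains every edge of the
    paths in [s], the minimum no longer distinguishes the hybrid from the homogeneous medium. *)
Lemma exchange_all t :
  (\int[P]_w (f (to_config (sided (fun=> b)) w))%:E <= \int[P]_w (f (to_config (sided t) w))%:E)%E.
Proof.
pose S := flatten (map (path_edges origin) s).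
pose hyb (r : seq edge) e := if e \in r then b else t e.
have H r : (\int[P]_w (f (to_config (sided (hyb r)) w))%:E <=
    \int[P]_w (f (to_config (sided t) w))%:E)%E.
  elim: r => [|e0 r IH]; first by rewrite (_ : hyb [::] = t)//; apply/funext.
  apply: le_trans IH; apply: (@exchange_one _ _ e0).
    by move=> e ee0; rewrite /hyb in_cons (negbTE ee0).
  by rewrite /hyb mem_head.
apply: le_trans (H S); rewrite le_eqVlt; apply/orP; left; apply/eqP.
apply: eq_integral => w _; congr (_%:E); apply: eq_min_weight => e eS.
by rewrite /to_config /sided /hyb /S eS.
Qed.

End exchange.

End model.

(** * Speed and its lower bound *)

Section speed.
Context {R : realType} {d : measure_display} {T : measurableType d}.
Variable P : probability T R.
Implicit Type Y : edge -> T -> R.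

Definition vertical_time Y (n : nat) (w : T) : R :=
  passage_time (to_config Y w) origin (0, n%:Z).

Definition time_below Y (n : nat) (c : R) : set T := [set w | vertical_time Y n w < c].

(** Convergence in probability of the normalised vertical times, split into its two one-sided
    halves. It follows from either kind of limit in the hypotheses. *)
Definition speed Y (m : R) : Prop :=
  (forall a, m < a -> forall delta : R, 0 < delta -> exists n0, forall n, (n0 <= n)%N ->
    ((1 - delta)%:E < P (time_below Y n (n%:R * a)%R))%E) /\
  (forall a, a < m -> forall delta : R, 0 < delta -> exists n0, forall n, (n0 <= n)%N ->
    ((1 - delta)%:E < P (~` time_below Y n (n%:R * a)%R))%E).

Definition fast_along Y (c : R) (s : seq (seq vertex)) : set T :=
  [set w | has (fun p => path_weight (to_config Y w) origin p < c) s].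

Definition vertical_path (n : nat) (p : seq vertex) := path nn origin p && (last origin p == (0, n%:Z)).

Definition vertical_paths n M : seq (seq vertex) :=
  [seq p <- pmap unpickle (iota 0 M) | vertical_path n p].

Section nonneg.
Variable Y : edge -> T -> R.
Hypothesis mY : forall e, measurable_fun setT (Y e).
Hypothesis Y0 : forall e w, 0 <= Y e w.

Lemma measurable_fast_along c s : measurable (fast_along Y c s).
Proof.
elim: s => [|p s IH].
  have -> : fast_along Y c [::] = set0 by apply/seteqP; split.
  exact: measurable0.
rewrite (_ : fast_along Y c (p :: s) =
  [set w | path_weight (to_config Y w) origin p < c] `|` fast_along Y c s).
  apply: measurableU => //; apply: measurable_fun_lt.
  exact: measurableT_comp (measurable_path_weight origin p) (measurable_to_config mY).
by apply/seteqP; split=> w; rewrite /fast_along/= => /orP.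
Qed.

(** Paths are countable, being coded by [pickle]. An infimum lies strictly below [c] exactly when
    some path does, so the strict inequality in [time_below] matters. *)
Lemma time_below_bigcup n c : time_below Y n c =
  \bigcup_M fast_along Y c (vertical_paths n M).
Proof.
apply/seteqP; split=> [w /= /passage_time_lt[p [pp lp pc]]|w [M _ /hasP[p]]].
- exists (pickle p).+1 => //; apply/hasP; exists p => //.
  rewrite mem_filter /vertical_path pp lp eqxx mem_pmap -pickleK.
  by rewrite map_f// mem_iota/= ltnSn.
- rewrite mem_filter => /andP[/andP[pp /eqP lp] _] pc /=.
  apply: le_lt_trans pc; rewrite /vertical_time -lp; apply: passage_time_le => //.
  by move=> e; exact: Y0.
Qed.

Lemma measurable_time_below n c : measurable (time_below Y n c).
Proof. by rewrite time_below_bigcup; apply: bigcup_measurable => M _; exact: measurable_fast_along. Qed.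

Lemma measurable_vertical_time n : measurable_fun setT (vertical_time Y n).
Proof.
apply: (measurability _ (RGenInftyO.measurableE R)).
move=> _ [_ [c ->] <-]; rewrite setTI.
rewrite (_ : _ @^-1` _ = time_below Y n c); first exact: measurable_time_below.
by apply/seteqP; split=> w; rewrite /= in_itv.
Qed.

(** Continuity from below. Both bounds pass through this reduction to a finite list of paths. *)
Lemma fast_along_approx n c (r : R) : (r%:E < P (time_below Y n c))%E ->
  exists2 s, all (vertical_path n) s & (r%:E < P (fast_along Y c s))%E.
Proof.
move=> rP.
have cvgG : (fun M => P (fast_along Y c (vertical_paths n M))) @ \oo -->
    P (time_below Y n c).
  rewrite time_below_bigcup; apply: nondecreasing_cvg_mu.
  - by move=> M; exact: measurable_fast_along.
  - by rewrite -time_below_bigcup; exact: measurable_time_below.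
  - move=> M N MN; apply/subsetPset => w /hasP[p ps pc]; apply/hasP; exists p => //.
    move: ps; rewrite !mem_filter !mem_pmap => /andP[-> /mapP[k kM ->]]/=.
    by apply: map_f; move: kM; rewrite !mem_iota/= !add0n => kM; exact: leq_trans kM MN.
have /cvgG [M _ HM] : nbhs (P (time_below Y n c)) (fun x : \bar R => r%:E < x)%E.
  have := rP; rewrite -(fineK (fin_num_measure P _ (measurable_time_below n c))) lte_fin.
  exact: (@nbhs_open_ereal_gt R _ (fun=> r)).
exists (vertical_paths n M); last by apply: HM => /=.
by apply/allP => p; rewrite mem_filter; case/andP => ? _.
Qed.

Lemma ae_speed m :
  (\forall w \ae P, (fun n => vertical_time Y n w / n%:R) @ \oo --> m) -> speed Y m.
Proof.
move=> aeY; split=> a ma.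
- apply: ae_eventually; first by move=> n; exact: measurable_time_below.
  apply: filterS aeY => w cw.
  (* The successor of [n0] is taken so that n is positive and can be multiplied out. *)
  have /cw [n0 _ Hn0] := lt_nbhsl ma.
  exists n0.+1 => // n /= nn0; have := Hn0 n (ltnW nn0).
  by rewrite /time_below /= ltr_pdivrMr 1?mulrC// ltr0n (leq_trans _ nn0).
- apply: ae_eventually; first by move=> n; apply: measurableC; exact: measurable_time_below.
  apply: filterS aeY => w cw.
  have /cw [n0 _ Hn0] := lt_nbhsr ma.
  exists n0.+1 => // n /= nn0; have := Hn0 n (ltnW nn0).
  rewrite /= ltr_pdivlMr ?ltr0n ?(leq_trans _ nn0)// mulrC => h.
  by apply/negP; rewrite -leNgt ltW.
Qed.

Lemma cvg_in_probability_speed m :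
  cvg_in_probability P (fun n w => vertical_time Y n w / n%:R) m -> speed Y m.
Proof.
move=> cP.
have key (A : nat -> set T) (eps : R) : 0 < eps -> (forall n, measurable (A n)) ->
    (forall n w, (0 < n)%N -> ~ A n w -> eps <= `|vertical_time Y n w / n%:R - m|) ->
    forall delta : R, 0 < delta ->
    exists n0, forall n, (n0 <= n)%N -> ((1 - delta)%:E < P (A n))%E.
  move=> e0 mA AP delta d0.
  have /(cP eps e0) [n0 _ Hn0] : nbhs 0%E (fun x : \bar R => x < delta%:E)%E.
    exact: (@nbhs_open_ereal_lt R 0 (fun=> delta)).
  exists n0.+1 => n nn0; rewrite -(setCK (A n)) probability_setC; last exact: measurableC.
  have n_gt0 : (0 < n)%N by exact: leq_ltn_trans nn0.
  have mn : measurable_fun setT (fun w => vertical_time Y n w / n%:R - m).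
    apply: measurable_funB => //; apply: measurable_funM => //.
    exact: measurable_vertical_time.
  have mB : measurable [set w | eps <= `|vertical_time Y n w / n%:R - m|].
    rewrite (_ : [set w | _] = ~` [set w | `|vertical_time Y n w / n%:R - m| < eps]).
      apply: measurableC; apply: measurable_fun_lt.
      exact: measurableT_comp mn.
    by apply/seteqP; split=> w /=; rewrite leNgt => /negP.
  have : (P (~` A n) < delta%:E)%E.
    apply: le_lt_trans (Hn0 n (ltnW nn0)); apply: le_measure; rewrite ?inE//.
      exact: measurableC.
    by move=> w; exact: AP.
  have : P (~` A n) \is a fin_num by apply: fin_num_measure; exact: measurableC.
  by case: (P (~` A n)) => // r _; rewrite -EFinB !lte_fin; lra.
split=> a ma.
- apply: (key _ (a - m)); first by rewrite subr_gt0.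
    by move=> n; exact: measurable_time_below.
  move=> n w n0 /negP; rewrite -leNgt => h.
  by apply: le_trans (ler_norm _); rewrite lerD2r ler_pdivlMr ?ltr0n// mulrC.
- apply: (key _ (m - a)); first by rewrite subr_gt0.
    by move=> n; apply: measurableC; exact: measurable_time_below.
  move=> n w n0 /contrapT /= h.
  rewrite distrC; apply: le_trans (ler_norm _); rewrite lerD2l lerN2 ler_pdivrMr ?ltr0n// mulrC.
  exact: ltW.
Qed.

End nonneg.

End speed.

Section lower_bound.
Context {R : realType} {d : measure_display} {T : measurableType d}.
Variables (P : probability T R) (F : bool -> probability R R) (X : edge -> T -> R).
Hypothesis mX : forall e, measurable_fun setT (X e).
Hypothesis X0 : forall e w, 0 <= X e w.
Hypothesis indX : mutually_independent P X.
Hypothesis lawX : forall e (B : set R), measurable B -> P (X e @^-1` B) = F (left_edge e) B.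

(** If mbar < m, take mbar < a < c < m and truncate at n c. In the medium [X] the truncated minimum
    has mean at most about n a; in the homogeneous medium every path weighs at least n c with high
    probability, so the mean is at least about n c. The exchange inequality forbids this. *)
Lemma speed_more_variable (b : bool) (mbar m : R) : more_variable (F b) (F (~~ b)) ->
  speed P X mbar -> speed P (sided X (fun=> b)) m -> m <= mbar.
Proof.
move=> Fb [fastX _] [_ slowZ]; rewrite leNgt; apply/negP => mbarm.
set Z := sided X (fun=> b) in slowZ.
have mZ e : measurable_fun setT (Z e) by exact: measurable_sided.
have Z0 e w : 0 <= Z e w by exact: sided_ge0.
pose a := mbar + (m - mbar) / 3; pose c := m - (m - mbar) / 3.
have ac : a < c by rewrite /a /c; lra.
have mbara : mbar < a by rewrite /a; lra.
have cm : c < m by rewrite /c; lra.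
have [n1 H1] := fastX a mbara 1 ltr01.
(* Times are nonnegative, yet the event that the time is below n a has positive probability:
   tolerance 1 gives 0 as strict lower bound. *)
have a0 : 0 < a.
  rewrite ltNge; apply/negP => a_le0.
  have := H1 n1 (leqnn _); rewrite subrr (_ : time_below _ _ _ = set0) ?measure0 ?ltxx//.
  apply/seteqP; split=> // w; rewrite /time_below/= => h.
  have : vertical_time X n1 w < 0 by apply: lt_le_trans h _; rewrite mulr_ge0_le0.
  by rewrite ltNge passage_time_ge0// => e; exact: X0.
(* Failures cost at most delta * c per unit length on each side, in total half of the gap c - a. *)
pose delta := (c - a) / (4 * c).
have c0 : 0 < c by lra.
have delta0 : 0 < delta by rewrite divr_gt0//; lra.
have deltac : delta * c = (c - a) / 4 by rewrite /delta; field; lra.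
have [n2 H2] := fastX a mbara delta delta0.
have [n3 H3] := slowZ c cm delta delta0.
pose n := (maxn n2 n3).+1.
have n_gt0 : 0 < n%:R :> R by rewrite ltr0n.
have := H2 n (leq_trans (leq_maxl n2 n3) (leqnSn _)).
have {H3} := H3 n (leq_trans (leq_maxr n2 n3) (leqnSn _)).
set A := ~` _ => PA /(fast_along_approx mX X0)[s sp Ps].
have L0 : 0 <= n%:R * c by rewrite mulr_ge0 ?ltW.
have := exchange_all mX X0 indX lawX s L0 Fb left_edge.
set f := fun x : config R edge => min_weight (n%:R * c) s x.
have mf : measurable_fun setT f by exact: measurable_min_weight.
have f0 (x : edge -> R) : (forall e, 0 <= x e) -> 0 <= f x by exact: min_weight_ge0.
rewrite (sided_left_edge_expectation mX X0 indX lawX mf f0) leNgt => /negP; apply.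
set G := fast_along X (n%:R * a) s in Ps.
have mG : measurable G by exact: measurable_fast_along.
have mA : measurable A by apply: measurableC; exact: measurable_time_below.
have up : (\int[P]_w (f (to_config X w))%:E <= (n%:R * a)%:E + (n%:R * c)%:E * P (~` G))%E.
  apply: integral_le_split => //.
  - exact: measurable_model.
  - by rewrite mulr_ge0 ?ltW.
  - by move=> w; apply: f0 => e; exact: X0.
  - by move=> w /hasP[p ps pa]; apply: le_trans (min_weight_le _ _ ps) (ltW pa).
  - by move=> w; exact: min_weight_leL.
have low : ((n%:R * c)%:E * P A <= \int[P]_w (f (to_config Z w))%:E)%E.
  apply: markov_le => //.
  - exact: measurable_model.
  - by move=> w; apply: f0 => e; exact: Z0.
  - move=> w /negP; rewrite -leNgt => Aw; apply/min_weight_geP; split=> // p ps.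
    apply: le_trans Aw _; have /andP[pp /eqP lp] := allP sp _ ps.
    by rewrite /vertical_time -lp; apply: passage_time_le => // e; exact: Z0.
apply: le_lt_trans up _; apply: lt_le_trans low.
rewrite probability_setC//.
have [pA eA] : exists r, P A = r%:E.
  by exists (fine (P A)); rewrite fineK// fin_num_measure.
have [pG eG] : exists r, P G = r%:E.
  by exists (fine (P G)); rewrite fineK// fin_num_measure.
rewrite eA eG in PA Ps *; move: PA Ps; rewrite !lte_fin => hA hG.
rewrite -!mulrA -mulrDr ltr_pM2l//; nra.
Qed.

End lower_bound.

(** * Integrability of the minimum of four weights *)

(** Reads a nested quadruple as a family indexed by [bool * bool], so that the fourfold product
    measure carries an independent family. *)
Definition sel {A : Type} (z : (A * A) * (A * A)) (i : bool * bool) : A :=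
  let p := if i.1 then z.2 else z.1 in if i.2 then p.2 else p.1.

Lemma sel_inj (q : quad) : uniq [:: q.1.1; q.1.2; q.2.1; q.2.2] -> injective (sel q).
Proof.
case: q => [[a b] [c e]]; rewrite /= !inE !negb_or => /and4P[/and3P[ab ac ae] /andP[bc be] ce _].
by move=> [[|] [|]] [[|] [|]] // h; exfalso; move: ab ac ae bc be ce; rewrite /sel/= in h;
  rewrite h ?eqxx.
Qed.

Section min4_tail.
Context {R : realType}.
Variable F : probability R R.
Hypothesis F_ge0 : supported_nonneg F.
Definition prob4 : probability _ R := ((F \x F) \x (F \x F))%E.
Local Notation Q := prob4.
Local Notation R4 := ((R * R) * (R * R))%type.

Definition coord (i : bool * bool) (z : R4) : R := sel z i.

Lemma measurable_coord i : measurable_fun setT (coord i).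
Proof.
have m1 : measurable_fun setT (fst : R4 -> R * R) by exact: measurable_fst.
have m2 : measurable_fun setT (snd : R4 -> R * R) by exact: measurable_snd.
case: i => [[|] [|]]; rewrite /coord /sel/=.
- exact: measurableT_comp m2.
- exact: measurableT_comp m2.
- exact: measurableT_comp m1.
- exact: measurableT_comp m1.
Qed.

Lemma rectangle_prob (B : bool * bool -> set R) : (forall i, measurable (B i)) ->
  Q [set z | forall i, B i (coord i z)] = (\prod_(i : bool * bool) fine (F (B i)))%:E.
Proof.
move=> mB; have -> : [set z | forall i, B i (coord i z)] =
    ((B (false, false) `*` B (false, true)) `*` (B (true, false) `*` B (true, true))).
  apply/seteqP; split=> [z Hz|[[a b] [c e]] [[/= Ba Bb] [/= Bc Be]] [[|] [|]] //].
  by split; split; [exact: (Hz (false, false))|exact: (Hz (false, true))|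
    exact: (Hz (true, false))|exact: (Hz (true, true))].
have ff (B1 : set R) : measurable B1 -> F B1 = (fine (F B1))%:E.
  by move=> mB1; rewrite fineK// fin_num_measure.
transitivity ((F \x F)%E (B (false, false) `*` B (false, true)) *
              (F \x F)%E (B (true, false) `*` B (true, true)))%E.
  rewrite /prob4; pose FF : probability _ R := (F \x F)%E.
  exact: (product_measure1E FF FF (measurableX (mB _) (mB _)) (measurableX (mB _) (mB _))).
have FF2 (A C : set R) : measurable A -> measurable C ->
    (F \x F)%E (A `*` C) = (fine (F A) * fine (F C))%:E.
  by move=> mA mC; rewrite EFinM -!ff//; exact: product_measure1E.
rewrite !FF2// -EFinM; congr (_%:E).
rewrite (eq_bigr (fun i => fine (F (B (i.1, i.2))))); last by move=> [].
rewrite -(pair_bigA _ (fun a b => fine (F (B (a, b)))))/= !big_bool/=.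
by rewrite [LHS]mulrC ![_ * fine (F (B (_, false)))]mulrC mulrC; ring.
Qed.

Lemma coord_law i (B : set R) : measurable B -> Q (coord i @^-1` B) = F B.
Proof.
move=> mB; pose B' j := if j == i then B else setT.
have mB' j : measurable (B' j) by rewrite /B'; case: eqP.
have -> : coord i @^-1` B = [set z | forall j, B' j (coord j z)].
  apply/seteqP; split=> [z Bz j|z /(_ i)]; last by rewrite /B' eqxx.
  by rewrite /B'; case: eqP => [->|].
rewrite rectangle_prob// (bigD1 i)//= big1 ?mulr1.
  by rewrite /B' eqxx fineK// fin_num_measure.
by move=> j /negbTE ji; rewrite /B' ji probability_setT.
Qed.

Lemma independent_coord : mutually_independent Q coord.
Proof.
move=> s B us mB; pose B' j := if j \in s then B j else setT.
have mB' j : measurable (B' j) by rewrite /B'; case: ifP.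
have -> : \big[setI/setT]_(i <- s) (coord i @^-1` B i) = [set z | forall j, B' j (coord j z)].
  rewrite -preimage_cylinder; apply/seteqP; split=> z Hz j.
    by rewrite /B'; case: ifP => // js; exact: (Hz j js).
  by move=> js; have := Hz j; rewrite /B' js.
transitivity (\prod_(i : bool * bool) fine (F (B' i))).
  by rewrite -[RHS]/(fine (_%:E)); congr fine; exact: rectangle_prob.
rewrite [RHS]big_uniq// [RHS]big_mkcond/=; apply: eq_bigr => j _.
rewrite /B'; case: ifP => js; last by rewrite probability_setT.
by congr fine; apply/esym; exact: coord_law.
Qed.

Definition excess (L : R) (x : config R (bool * bool)%type) : R :=
  Num.max (Num.min (Num.min (x (false, false)) (x (false, true)))
                   (Num.min (x (true, false)) (x (true, true))) - L) 0.

Lemma measurable_excess L : measurable_fun setT (excess L).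
Proof.
apply: measurable_maxr => //; apply: measurable_funB => //.
by do 2 (apply: measurable_minr => //); exact: measurable_eval.
Qed.

Lemma excess_ge0 L x : 0 <= excess L x.
Proof. by rewrite /excess le_max lexx orbT. Qed.

(** The support condition makes the minimum of the coordinates almost everywhere nonnegative, hence
    equal to its positive part, so a finite integral gives integrability. *)
Lemma integrable_excess0 : min4_finite_mean F ->
  Q.-integrable setT (fun z => (excess 0 (to_config coord z))%:E).
Proof.
move=> F4.
have mE : measurable_fun setT (fun z => (excess 0 (to_config coord z))%:E).
  apply/measurable_EFinP; apply: measurableT_comp (measurable_excess 0) _.
  exact: measurable_to_config measurable_coord.
have m4 : measurable_fun setT (fun z : R4 =>
   (Num.min (Num.min z.1.1 z.1.2) (Num.min z.2.1 z.2.2))%:E).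
  apply/measurable_EFinP; apply: measurable_minr; apply: measurable_minr.
  - exact: (measurable_coord (false, false)).
  - exact: (measurable_coord (false, true)).
  - exact: (measurable_coord (true, false)).
  - exact: (measurable_coord (true, true)).
have mneg : measurable [set r : R | r < 0] by exact: measurable_fun_lt.
have F0 : F [set r | r < 0] = 0%E.
  have -> : [set r : R | r < 0] = ~` `[0, +oo[%classic.
    by apply/seteqP; split=> r /=; rewrite in_itv/= andbT ltNge => /negP.
  by rewrite probability_setC// (F_ge0) subee.
have ae0 i : \forall z \ae Q, 0 <= coord i z.
  exists (coord i @^-1` [set r | r < 0]); split.
  - by rewrite -[X in measurable X]setTI; exact: measurable_coord.
  - by transitivity (F [set r | r < 0]); [exact: coord_law|exact: F0].
  - by move=> z /= /negP; rewrite -ltNge.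
apply/integrableP; split; first exact: mE.
have {}F4 : (\int[Q]_z (Num.min (Num.min z.1.1 z.1.2) (Num.min z.2.1 z.2.2))%:E < +oo)%E.
  move: F4; rewrite /min4_finite_mean.
  rewrite (eq_measure_integral prob4).
    by [].
  by move=> A _ _; rewrite /prob4.
apply: le_lt_trans F4; rewrite le_eqVlt; apply/orP; left; apply/eqP.
transitivity (\int[Q]_z (excess 0 (to_config coord z))%:E)%E.
  apply: eq_integral => z _; apply: gee0_abs; rewrite lee_fin; exact: excess_ge0.
apply: (ae_eq_integral _ _ measurableT mE m4).
apply: filterS (filterI (filterI (ae0 (false, false)) (ae0 (false, true)))
   (filterI (ae0 (true, false)) (ae0 (true, true)))).
move=> z [[z1 z2] [z3 z4]] _; rewrite /excess /to_config subr0; congr (_%:E).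
by apply/max_idPl; rewrite !le_min; apply/andP; split; apply/andP.
Qed.

(** Dominated convergence along integer levels, dominated by the excess over 0; at each point the
    excess vanishes eventually. *)
Lemma excess_tail (eps : R) : min4_finite_mean F -> 0 < eps ->
  exists2 L : R, 0 <= L & (\int[Q]_z (excess L (to_config coord z))%:E <= eps%:E)%E.
Proof.
move=> F4 eps0.
have mE L : measurable_fun setT (fun z => (excess L (to_config coord z))%:E).
  apply/measurable_EFinP; apply: measurableT_comp (measurable_excess L) _.
  exact: measurable_to_config measurable_coord.
have pointwise z : (fun n => (excess n%:R (to_config coord z))%:E) @ \oo --> (0 : \bar R)%E.
  apply: cvg_near_cst; set m := Num.min (Num.min (coord (false, false) z) (coord (false, true) z))
    (Num.min (coord (true, false) z) (coord (true, true) z)).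
  exists (Num.bound m) => // n /= mn; congr (_%:E); apply/max_idPr.
  by rewrite subr_le0 (le_trans (ltW (unstable.ltr_bound m)))// ler_nat.
have dom n z : (`|(excess n%:R (to_config coord z))%:E| <= (excess 0 (to_config coord z))%:E)%E.
  rewrite gee0_abs ?lee_fin ?excess_ge0// /excess subr0.
  by rewrite ge_max !le_max lerBlDr lerDl ler0n lexx orbT.
have [_ _] := dominated_convergence measurableT (fun n => mE n%:R) (measurable_cst (0 : \bar R)%E)
  (aeW Q (fun z _ => pointwise z)) (integrable_excess0 F4) (aeW Q (fun z n _ => dom n z)).
rewrite integral_cst// mul0e => H.
have /H [n _ Hn] : nbhs 0%E (fun x : \bar R => x < eps%:E)%E.
  exact: (@nbhs_open_ereal_lt R 0 (fun=> eps)).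
by exists n%:R => //; apply: ltW; exact: (Hn n (leqnn n)).
Qed.

(** The level depends only on [F] and [eps]: any four distinct edges of any such medium have the
    same joint law. *)
Lemma min4_tail (eps : R) : min4_finite_mean F -> 0 < eps -> exists2 L : R, 0 <= L &
  forall (d : measure_display) (T : measurableType d) (P : probability T R) (Z : edge -> T -> R),
    (forall e, measurable_fun setT (Z e)) -> mutually_independent P Z ->
    (forall e (B : set R), measurable B -> P (Z e @^-1` B) = F B) ->
    forall q : quad, uniq [:: q.1.1; q.1.2; q.2.1; q.2.2] ->
    (\int[P]_w (Num.max (min4 (to_config Z w) q - L) 0)%:E <= eps%:E)%E.
Proof.
move=> F4 eps0; have [L L0 HL] := excess_tail F4 eps0.
exists L => // d T P Z mZ indZ lawZ q uq; apply: le_trans HL.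
rewrite -(independent_expectation_unique (X := fun i => Z (sel q i)) (P := P) _ measurable_coord
  (independent_reindex (sel_inj uq) indZ) independent_coord (measurable_excess L)) //.
- by move=> w; exact: excess_ge0.
- by move=> w; exact: excess_ge0.
- by move=> i B mB; rewrite lawZ//; apply/esym; exact: coord_law.
Qed.

End min4_tail.

(** * Upper bound *)

Section more_probability.
Context {R : realType} {d : measure_display} {T : measurableType d}.
Variable P : probability T R.

Lemma integral_sum_le (I : eqType) (s : seq I) (h : I -> T -> R) (c : R) :
  (forall i, measurable_fun setT (h i)) -> (forall i w, 0 <= h i w) ->
  (forall i, i \in s -> (\int[P]_w (h i w)%:E <= c%:E)%E) ->
  (\int[P]_w (\sum_(i <- s) h i w)%:E <= ((size s)%:R * c)%:E)%E.
Proof.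
move=> mh h0 hc; under eq_integral do rewrite -sumEFin.
rewrite ge0_integral_sum//; last 2 first.
- by move=> i; apply/measurable_EFinP.
- by move=> i w _; rewrite lee_fin.
elim: s hc => [|i s IH] hc; first by rewrite big_nil mul0r.
rewrite big_cons /= -[(size s).+1]add1n natrD mulrDl mul1r EFinD; apply: leeD.
  by apply: hc; rewrite mem_head.
by apply: IH => j js; apply: hc; rewrite in_cons js orbT.
Qed.

Lemma prob_setI_gt (A B : set T) (a b : R) : measurable A -> measurable B ->
  ((1 - a)%:E < P A)%E -> ((1 - b)%:E < P B)%E -> ((1 - (a + b))%:E < P (A `&` B))%E.
Proof.
move=> mA mB hA hB.
have [pA eA] : exists r, P A = r%:E by exists (fine (P A)); rewrite fineK// fin_num_measure.
have [pB eB] : exists r, P B = r%:E by exists (fine (P B)); rewrite fineK// fin_num_measure.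
have mI := measurableI _ _ mA mB.
have [pI eI] : exists r, P (A `&` B) = r%:E.
  by exists (fine (P (A `&` B))); rewrite fineK// fin_num_measure.
have : (P (~` A `|` ~` B) <= P (~` A) + P (~` B))%E.
  by apply: measureU2; exact: measurableC.
rewrite -setCI !probability_setC// eA eB eI -!EFinB -EFinD lee_fin => h.
by move: hA hB; rewrite eA eB !lte_fin; lra.
Qed.

End more_probability.

Definition shift_quad (v : vertex) (q : quad) : quad :=
  ((shift v q.1.1, shift v q.1.2), (shift v q.2.1, shift v q.2.2)).

Lemma uniq_shift_quad v q : uniq [:: q.1.1; q.1.2; q.2.1; q.2.2] ->
  let q' := shift_quad v q in uniq [:: q'.1.1; q'.1.2; q'.2.1; q'.2.2].
Proof.
move=> uq; suff : uniq (map (shift v) [:: q.1.1; q.1.2; q.2.1; q.2.2]) by [].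
by rewrite map_inj_uniq//; exact: shift_inj.
Qed.

Section upper_bound.
Context {R : realType} {d : measure_display} {T : measurableType d}.
Variables (P : probability T R) (F : bool -> probability R R) (X : edge -> T -> R).
Hypothesis mX : forall e, measurable_fun setT (X e).
Hypothesis X0 : forall e w, 0 <= X e w.
Hypothesis indX : mutually_independent P X.
Hypothesis lawX : forall e (B : set R), measurable B -> P (X e @^-1` B) = F (left_edge e) B.
Hypothesis F_ge0 : forall b, supported_nonneg (F b).
Hypothesis F_min4 : forall b, min4_finite_mean (F b).

(** Bounds the passage time of a block for every nonnegative configuration, yet reads finitely many
    edges; a constant cap would lose the first property. *)
Definition block_time K s (x : edge -> R) : R := min_weight (bridge x K) s x.

Lemma measurable_block_time K s : measurable_fun setT (block_time K s : config R edge -> R).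
Proof. by apply: measurable_min_weight; exact: measurable_bridge. Qed.

Lemma block_time_ge0 K s (x : edge -> R) : (forall e, 0 <= x e) -> 0 <= block_time K s x.
Proof. by move=> x0; apply: min_weight_ge0 => //; exact: bridge_ge0. Qed.

Lemma passage_time_block K s (x : edge -> R) : (forall e, 0 <= x e) -> all (vertical_path K) s ->
  passage_time x origin (0, K%:Z) <= block_time K s x.
Proof.
move=> x0 sK; apply/min_weight_geP; split=> [|p ps]; first exact: passage_time_bridge.
by have /andP[pp /eqP lp] := allP sK _ ps; rewrite -lp; exact: passage_time_le.
Qed.

Variable b : bool.
Let Z := sided X (fun=> b).
Let mZ e : measurable_fun setT (Z e) := measurable_sided mX _ e.
Let Z0 e w : 0 <= Z e w := sided_ge0 X0 _ e w.
Let indZ : mutually_independent P Z := independent_sided indX _.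
Let lawZ e (B : set R) : measurable B -> P (Z e @^-1` B) = F b B.
Proof. by move=> mB; exact: (sided_law lawX (fun=> b) e mB). Qed.

(** When no listed path is fast, the block costs at most the bridge, a sum of K * q minima with q
    the size of [quads]. This is linear in K, and the level L and the tolerance delta are chosen
    before K, so the mean cost of failure stays a small multiple of K. *)
Lemma block_expectation m a : speed P Z m -> m < a ->
  exists K s, [/\ (0 < K)%N, all (vertical_path K) s &
    (\int[P]_w (block_time K s (to_config Z w))%:E <= (K%:R * a)%:E)%E].
Proof.
(* One g goes to the fast paths, one to the excess over L, one to L on the failure event. *)
move=> [fastZ _] ma; pose g := (a - m) / 4; have g0 : 0 < g by rewrite /g; lra.
pose q := (size quads)%:R : R.
have q0 : 0 < q by rewrite ltr0n.
have gq0 : 0 < g / q by rewrite divr_gt0.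
have [L L0 HL] := min4_tail (F_ge0 b) (F_min4 b) gq0.
(* The second term yields L * delta <= g / q, with L + 1 avoiding division by 0; the first keeps
   delta below 1, so the success event is nonempty. *)
pose delta := Num.min 2^-1 (g / (q * (L + 1))).
have qL : 0 < q * (L + 1) by rewrite mulr_gt0// ltr_wpDl.
have delta0 : 0 < delta by rewrite lt_min invr_gt0 ltr0n divr_gt0.
have delta1 : delta < 1 by rewrite /delta gt_min; apply/orP; left; lra.
have deltaL : L * delta <= g / q.
  apply: (@le_trans _ _ ((L + 1) * (g / (q * (L + 1))))).
    by apply: ler_pM; rewrite ?(ltW delta0)// ?lerDl// ge_min lexx orbT.
  by rewrite le_eqVlt; apply/orP; left; apply/eqP; field; lra.
have [n0 /(_ n0.+1 (leqnSn _))] := fastZ (m + g) ltac:(lra) delta delta0.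
move/(fast_along_approx mZ Z0) => [s sK Ps].
set K := n0.+1 in sK Ps *; set G := fast_along _ _ _ in Ps.
have mG : measurable G by exact: measurable_fast_along.
have Kmg : 0 <= K%:R * (m + g).
  rewrite leNgt; apply/negP => neg.
  have G0 : G = set0.
    apply/seteqP; split=> // w /hasP[p _ pK].
    have : path_weight (to_config Z w) origin p < 0 by exact: lt_trans neg.
    by rewrite ltNge path_weight_ge0// => e; exact: Z0.
  by move: Ps; rewrite G0 measure0 lte_fin; lra.
exists K, s; split=> //.
(* A minimum is at most L plus its excess; L is charged only on the failure event. *)
pose h (i : nat) (qd : quad) w : R :=
  Num.max (min4 (to_config Z w) (shift_quad (0, i%:Z) qd) - L) 0 + L * \1_(~` G) w.
have h0 i qd w : 0 <= h i qd w.
  by rewrite addr_ge0 ?le_max ?lexx ?orbT// mulr_ge0// indicE ler0n.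
have mexc i qd : measurable_fun setT (fun w => Num.max (min4 (to_config Z w) (shift_quad (0, i%:Z) qd) - L) 0).
  apply: measurable_maxr => //; apply: measurable_funB => //.
  exact: measurableT_comp (measurable_min4 _) (measurable_to_config mZ).
have mind : measurable_fun setT (fun w => L * \1_(~` G) w).
  by apply: measurable_funM => //; apply: measurable_indic; exact: measurableC.
have mh i qd : measurable_fun setT (h i qd) by exact: measurable_funD.
have PGC : (P (~` G) <= delta%:E)%E.
  have [pG eG] : exists r, P G = r%:E by exists (fine (P G)); rewrite fineK// fin_num_measure.
  by move: Ps; rewrite probability_setC// eG lte_fin -EFinB lee_fin; lra.
have Eh i qd : qd \in quads -> (\int[P]_w (h i qd w)%:E <= (g / q + g / q)%:E)%E.
  move=> qdq; under eq_integral do rewrite EFinD.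
  rewrite ge0_integralD//; last 4 first.
  - by move=> w _; rewrite lee_fin le_max lexx orbT.
  - exact/measurable_EFinP.
  - by move=> w _; rewrite lee_fin mulr_ge0// indicE ler0n.
  - exact/measurable_EFinP.
  rewrite EFinD; apply: leeD.
    by apply: HL => //; apply: uniq_shift_quad; exact: quads_uniq.
  under eq_integral do rewrite EFinM.
  rewrite ge0_integralZl//; last first.
    by apply/measurable_EFinP; apply: measurable_indic; exact: measurableC.
  rewrite integral_indic ?setIT//; last exact: measurableC.
  apply: le_trans (_ : (L%:E * delta%:E <= _)%E); last by rewrite -EFinM lee_fin.
  by apply: lee_wpmul2l => //; rewrite lee_fin.
pose H i w := \sum_(qd <- quads) h i qd w.
have mH i : measurable_fun setT (H i) by apply: measurable_sum.
have H0 i w : 0 <= H i w by apply: sumr_ge0.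
have EH i : (\int[P]_w (H i w)%:E <= (g + g)%:E)%E.
  apply: le_trans (integral_sum_le _ _ (Eh i)) _ => //.
  by rewrite lee_fin -/q le_eqVlt; apply/orP; left; apply/eqP; field; lra.
pose HK w := \sum_(i <- index_iota 0 K) H i w.
have mHK : measurable_fun setT HK by apply: measurable_sum.
have HK0 w : 0 <= HK w by apply: sumr_ge0.
have EHK : (\int[P]_w (HK w)%:E <= (K%:R * (g + g))%:E)%E.
  apply: le_trans (integral_sum_le _ _ (fun i _ => EH i)) _ => //.
  by rewrite size_iota subn0.
have pointwise w : block_time K s (to_config Z w) <= K%:R * (m + g) + HK w.
  have [wG|nwG] := pselect (G w).
    have /hasP[p ps /ltW pK] := wG.
    by apply: le_trans (min_weight_le _ _ ps) _; apply: le_trans pK _; rewrite lerDl.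
  apply: le_trans (min_weight_leL _ _ _) _; apply: (@le_trans _ _ (HK w)); last by rewrite lerDr.
  rewrite /bridge /HK -(big_mkord xpredT (fun i : nat =>
    \sum_(qd <- quads) min4 (to_config Z w \o shift (0, i%:Z)) qd)).
  apply: ler_sum => i _; apply: ler_sum => qd _.
  rewrite /h indicE mem_set// mulr1 -lerBlDr le_max; apply/orP; left; exact: lexx.
apply: (@le_trans _ _ (\int[P]_w (K%:R * (m + g) + HK w)%:E)%E).
  apply: ge0_le_integral => //.
  - by move=> w _; rewrite lee_fin; apply: block_time_ge0 => e; exact: Z0.
  - by apply/measurable_EFinP; exact: measurable_model (measurable_block_time K s).
  - by apply/measurable_EFinP; exact: measurable_funD.
  - by move=> w _; rewrite lee_fin; exact: pointwise.
under eq_integral do rewrite EFinD.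
rewrite ge0_integralD//; last 2 first.
- by move=> w _; rewrite lee_fin.
- exact/measurable_EFinP.
rewrite integral_cst// [X in (_ * X + _)%E]probability_setT mule1.
apply: le_trans (leeD (lexx _) EHK) _.
by rewrite -EFinD lee_fin -mulrDr ler_wpM2l// /g; lra.
Qed.

Definition shifted (v : vertex) (e : edge) : T -> R := X (shift v e).

Lemma measurable_shifted v e : measurable_fun setT (shifted v e).
Proof. exact: mX. Qed.

Lemma independent_shifted v : mutually_independent P (shifted v).
Proof. exact: independent_reindex (@shift_inj v) indX. Qed.

(** The finitely many edges read by the block are moved into half-plane [b], where [X] has the law
    of [Z]. *)
Lemma block_shift_expectation K s : exists c : int, forall j : int,
  (\int[P]_w (block_time K s (to_config (shifted (c, j)) w))%:E =
   \int[P]_w (block_time K s (to_config Z w))%:E)%E.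
Proof.
pose S := bridge_edges K ++ flatten (map (path_edges origin) s).
have [c Hc] := exists_half_plane_shift S b; exists c => j.
apply: (@independent_expectation_unique_on _ _ _ _ _ _ _ _ _ _ S) => //.
- exact: measurable_shifted.
- exact: independent_shifted.
- exact: measurable_block_time.
- move=> x y xy; rewrite /block_time.
  rewrite (@eq_bridge _ K x y); last by move=> e eK; apply: xy; rewrite mem_cat eK.
  by apply: eq_min_weight => e es; apply: xy; rewrite mem_cat es orbT.
- by move=> w; apply: block_time_ge0 => e; exact: X0.
- by move=> w; apply: block_time_ge0 => e; exact: X0.
- by move=> e eS B mB; rewrite lawZ// lawX// Hc.
Qed.

(** The route goes to column c along [p0], climbs [N] blocks, and returns along the translate of
    [p1]. *)
Lemma vertical_time_le K s c p0 p1 N w : all (vertical_path K) s ->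
  path nn origin p0 -> last origin p0 = (c, 0) -> path nn (c, 0) p1 -> last (c, 0) p1 = origin ->
  vertical_time X (N * K) w <= path_weight (to_config X w) origin p0 +
    \sum_(j <- index_iota 0 N) block_time K s (to_config (shifted (c, (j * K)%N%:Z)) w) +
    path_weight (to_config (shifted (0, (N * K)%N%:Z)) w) (c, 0) p1.
Proof.
move=> sK pp0 lp0 pp1 lp1; set x := to_config X w.
have x0 e : 0 <= x e by exact: X0.
apply: le_trans (passage_time_triangle x0 _ (c, (N * K)%N%:Z) _) _; apply: lerD.
  apply: le_trans (passage_time_triangle x0 _ (c, 0) _) _; apply: lerD.
    by rewrite -lp0; exact: passage_time_le.
  have := passage_time_concat x0 (fun j => (c, (j * K)%N%:Z)) N.
  rewrite mul0n big_mkord => /le_trans; apply; apply: ler_sum => j _.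
  have -> : (c, (j.+1 * K)%N%:Z) = addv (0, K%:Z) (c, (j * K)%N%:Z).
    by rewrite /addv/= add0r mulSn PoszD.
  rewrite -{1}(add0v (c, (j * K)%N%:Z)).
  apply: le_trans (passage_time_shift x0 _ _ _) _.
  by apply: passage_time_block => // e; exact: x0.
have -> : (c, (N * K)%N%:Z) = addv (c, 0) (0, (N * K)%N%:Z) by rewrite /addv/= addr0 add0r.
rewrite -{2}(add0v (0, (N * K)%N%:Z)); apply: le_trans (passage_time_shift x0 _ _ _) _.
by rewrite -lp1; apply: passage_time_le => // e; exact: x0.
Qed.

Lemma eventually_small (u : vertex) p g : 0 < g -> forall delta : R, 0 < delta ->
  exists n0, forall n, (n0 <= n)%N ->
    ((1 - delta)%:E < P [set w | (path_weight (to_config X w) u p < n%:R * g)%R])%E.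
Proof.
move=> g0; apply: ae_eventually.
  move=> n; apply: measurable_fun_lt.
  exact: measurable_model mX (measurable_path_weight u p).
apply: aeW => w; exists (Num.bound (path_weight (to_config X w) u p / g)) => // n /= nb.
rewrite -ltr_pdivrMr//; apply: lt_le_trans (unstable.ltr_bound _) _.
by rewrite ler_nat.
Qed.

(** Vertical translations preserve the half-planes. The return path moves with n, so its cost is
    controlled in law rather than pointwise. *)
Lemma shifted_law m (A : set (config R edge)) : measurable A ->
  P (to_config (shifted (0, m)) @^-1` A) = P (to_config X @^-1` A).
Proof.
move=> mA; apply: (independent_law_unique _ mX (independent_shifted _) indX) => //.
  exact: measurable_shifted.
by move=> e B mB; rewrite !lawX// !left_edgeE /shift /addv/= addr0.
Qed.

(** Suppose m < mbar. With probability above 1 - 3 delta the time is at least n (mbar - g) and both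
    connecting paths cost less than n g, so the blocks cost at least n beta; their mean is at most n
    (m + g), against Markov's inequality. *)
Lemma speed_half_plane (mbar m : R) : speed P X mbar -> speed P Z m -> mbar <= m.
Proof.
move=> [_ slowX] speedZ; rewrite leNgt; apply/negP => mmbar.
(* Then mbar - 3 g = m + 5 g exceeds beta = m + 2 g, and delta * beta = g / 4 makes beta (1 - 3
   delta) exceed m + g. *)
pose g := (mbar - m) / 8; have g0 : 0 < g by rewrite /g; lra.
have [K [s [K0 sK EK]]] := block_expectation speedZ (ltac:(lra) : m < m + g).
have [c Ec] := block_shift_expectation K s.
have K0' : 0 < K%:R :> R by rewrite ltr0n.
have alpha0 : 0 <= m + g.
  have : (0%:E <= (K%:R * (m + g))%:E)%E.
    apply: le_trans EK; apply: integral_ge0 => w _; rewrite lee_fin.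
    by apply: block_time_ge0 => e; exact: Z0.
  by rewrite lee_fin pmulr_rge0.
pose beta := m + 2 * g; have beta0 : 0 < beta by rewrite /beta; lra.
pose delta := (beta - (m + g)) / (4 * beta).
have delta0 : 0 < delta by rewrite divr_gt0 /beta; lra.
have deltab : delta * beta = g / 4 by rewrite /delta /beta; field; lra.
have [p0 [pp0 lp0]] := exists_path origin (c, 0).
have [p1 [pp1 lp1]] := exists_path (c, 0) origin.
have [n1 H1] := slowX (mbar - g) ltac:(lra) delta delta0.
have [n2 H2] := eventually_small origin p0 g0 delta0.
have [n3 H3] := eventually_small (c, 0) p1 g0 delta0.
pose N := (n1 + n2 + n3).+1; pose n := (N * K)%N.
have Nn : (N <= n)%N by rewrite leq_pmulr.
have n1n : (n1 <= n)%N by apply: leq_trans Nn; rewrite /N leqW// -addnA leq_addr.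
have n2n : (n2 <= n)%N by apply: leq_trans Nn; rewrite /N leqW// addnAC leq_addl.
have n3n : (n3 <= n)%N by apply: leq_trans Nn; rewrite /N leqW// leq_addl.
have n0 : 0 < n%:R :> R by rewrite ltr0n; apply: leq_trans Nn.
have {H1} := H1 n n1n; have {H2} := H2 n n2n; have {H3} := H3 n n3n.
have mD : measurable [set x : config R edge | path_weight x (c, 0) p1 < n%:R * g].
  by apply: measurable_fun_lt; exact: measurable_path_weight.
rewrite -[X in P X]/(to_config X @^-1` [set x : config R edge | path_weight x (c, 0) p1 < n%:R * g]).
rewrite -(shifted_law n%:Z mD).
set D := _ @^-1` _ => PD; set C := [set w | _] => PC; set A := ~` _ => PA.
have mA : measurable A by apply: measurableC; exact: measurable_time_below.
have mC : measurable C.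
  by apply: measurable_fun_lt; exact: measurable_model mX (measurable_path_weight origin p0).
have mD' : measurable D.
  rewrite -[D]setTI; exact: (measurable_to_config (measurable_shifted (0, n%:Z))).
have PACD := prob_setI_gt (measurableI _ _ mA mC) mD' (prob_setI_gt mA mC PA PC) PD.
pose W w := \sum_(j <- index_iota 0 N) block_time K s (to_config (shifted (c, (j * K)%N%:Z)) w).
have mblock j : measurable_fun setT (fun w => block_time K s (to_config (shifted (c, (j * K)%N%:Z)) w)).
  exact: measurable_model (measurable_shifted _) (measurable_block_time K s).
have block0 j w : 0 <= block_time K s (to_config (shifted (c, (j * K)%N%:Z)) w).
  by apply: block_time_ge0 => e; exact: X0.
have mW : measurable_fun setT W by apply: measurable_sum.
have W0 w : 0 <= W w by apply: sumr_ge0.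
have EW : (\int[P]_w (W w)%:E <= (n%:R * (m + g))%:E)%E.
  apply: (@le_trans _ _ ((size (index_iota 0 N))%:R * (K%:R * (m + g)))%:E).
    by apply: integral_sum_le => // j _; rewrite Ec.
  by rewrite size_iota subn0 /n natrM mulrA.
have low : ((n%:R * beta)%:E * P (A `&` C `&` D) <= \int[P]_w (W w)%:E)%E.
  apply: markov_le => //.
  - by apply: measurableI => //; exact: measurableI.
  - by rewrite mulr_ge0 ?ltW.
  - move=> w [[/negP Aw Cw] Dw]; rewrite -leNgt in Aw.
    have := vertical_time_le N w sK pp0 lp0 pp1 lp1; rewrite -/n -/(W w) => h.
    have := le_trans Aw h; move: Cw Dw; rewrite /C /D /=.
    have -> : n%:R * beta = n%:R * (mbar - g) - n%:R * g - n%:R * g - n%:R * (3 * g) :> R.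
      by rewrite /beta /g; field.
    have : 0 <= n%:R * (3 * g) by apply: mulr_ge0; [exact: ltW|lra].
    by lra.
have mACD : measurable (A `&` C `&` D) by apply: measurableI => //; exact: measurableI.
have [pI eI] : exists r, P (A `&` C `&` D) = r%:E.
  by exists (fine (P (A `&` C `&` D))); rewrite fineK// fin_num_measure.
have := le_trans low EW; move: PACD; rewrite eI lte_fin -EFinM lee_fin -mulrA ler_pM2l// => h1 h2.
have : (1 - (delta + delta + delta)) * beta <= pI * beta by rewrite ler_pM2r// ltW.
have -> : (1 - (delta + delta + delta)) * beta = beta - 3 * (delta * beta) by ring.
by rewrite deltab; have : beta = m + 2 * g by []; lra.
Qed.

End upper_bound.

(** * Reduction to nonnegative weights and conclusion *)

Unset Implicit Arguments.

Theorem theorem4 (R : realType) (Fm Fp : probability R R)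
  (d : measure_display) (T : measurableType d) (P : probability T R)
  (tau : edge -> T -> R) (mubar mum mup : R) :
  supported_nonneg Fm -> supported_nonneg Fp ->
  inhom_fpp P tau Fm Fp ->
  min4_finite_mean Fm -> min4_finite_mean Fp ->
  (\forall w \ae P,
     (fun n : nat => passage_time (fun e => tau e w) (0, 0) (scale_vertex n e2) / n%:R)
       @ \oo --> mubar) ->
  time_constant_is Fm e2 mum ->
  time_constant_is Fp e2 mup ->
  mubar <= Num.min mum mup /\
  (more_variable Fm Fp \/ more_variable Fp Fm -> mubar = Num.min mum mup).
Proof.
move=> Fm0 Fp0 [indtau lawtau] Fm4 Fp4 cvgtau tcm tcp.
pose F (b : bool) := if b then Fm else Fp.
have F0 b : supported_nonneg (F b) by case: b.
have F4 b : min4_finite_mean (F b) by case: b.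
(* The weights are nonnegative only almost surely; their positive parts satisfy the path estimates
   everywhere. *)
pose pos (r : R) := Num.max r 0.
have mpos : measurable_fun setT pos by apply: measurable_maxr.
pose X e w := pos (tau e w).
have mtau e : measurable_fun setT (tau e) by have [] := lawtau e.
have mX e : measurable_fun setT (X e) by exact: measurableT_comp.
have X0 e w : 0 <= X e w by rewrite /X /pos le_max lexx orbT.
have indX : mutually_independent P X := independent_comp (fun=> mpos) indtau.
have Fneg b : F b [set r | r < 0] = 0%E.
  have -> : [set r : R | r < 0] = ~` `[0, +oo[%classic.
    by apply/seteqP; split=> r /=; rewrite in_itv/= andbT ltNge => /negP.
  by rewrite probability_setC// (F0 b) subee.
have mneg : measurable [set r : R | r < 0] by exact: measurable_fun_lt.
have tauF e (B : set R) : measurable B -> P (tau e @^-1` B) = F (left_edge e) B.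
  by move=> mB; have [_ ->//] := lawtau e; rewrite /F; case: ifP.
have tauneg e : P (tau e @^-1` [set r | r < 0]) = 0%E by rewrite tauF.
have mpre e (B : set R) : measurable B -> measurable (tau e @^-1` B).
  by move=> mB; rewrite -[X in measurable X]setTI; exact: mtau.
(* Countability of the edges, via [pickle], gives a single null set for all of them. *)
have aetau : \forall w \ae P, forall e, X e w = tau e w.
  have : \forall w \ae P, forall k : nat, if unpickle k is Some e then 0 <= tau e w else true.
    apply/ae_foralln => k; case: (unpickle k) => [e|]; last exact: aeW.
    exists (tau e @^-1` [set r | r < 0]); split; [exact: mpre|exact: tauneg|].
    by move=> w /= /negP; rewrite -ltNge.
  apply: filterS => w H e; have := H (pickle e); rewrite pickleK => taue.
  exact/max_idPl.
have lawX e (B : set R) : measurable B -> P (X e @^-1` B) = F (left_edge e) B.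
  move=> mB; have mposB : measurable (pos @^-1` B) by rewrite -[X in measurable X]setTI; exact: mpos.
  have le_F (A C : set R) : measurable A -> measurable C -> A `<=` C `|` [set r | r < 0] ->
      (F (left_edge e) A <= F (left_edge e) C)%E.
    move=> mA mC AC; apply: (@le_trans _ _ (F (left_edge e) (C `|` [set r | r < 0]))).
      by apply: le_measure; rewrite ?inE//; exact: measurableU.
    apply: le_trans (measureU2 _ mC mneg) _.
    by rewrite [X in (_ + X)%E](Fneg _) adde0.
  transitivity (F (left_edge e) (pos @^-1` B)); first by rewrite -tauF.
  have posE r : r < 0 \/ pos r = r.
    by rewrite /pos; case: (ltP r 0); [left|right].
  apply/le_anti/andP; split; apply: le_F => // r Br; have [r0|rE] := posE r; try by right.
    by left; rewrite -rE.
  by left; rewrite /= rE.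
have scale n : scale_vertex n e2 = (0, n%:Z) by rewrite /scale_vertex /e2/= mul0rn natz.
have speedX : speed P X mubar.
  apply: ae_speed => //; apply: filterS2 aetau cvgtau => w Xtau.
  have -> : (fun e => tau e w) = to_config X w by apply/funext => e; rewrite -Xtau.
  by under eq_fun do rewrite scale.
pose mu b := if b then mum else mup.
(* The time constant is assumed for every homogeneous model, in particular for this one on the given
   space. *)
have speedZ b : speed P (sided X (fun=> b)) (mu b).
  apply: cvg_in_probability_speed; first exact: (measurable_sided mX).
    exact: (sided_ge0 X0).
  have hZ : hom_fpp P (sided X (fun=> b)) (F b).
    split; first exact: independent_sided.
    move=> e; split; first exact: measurable_sided.
    by move=> B mB; exact: (sided_law lawX (fun=> b) e mB).
  have : cvg_in_probability P (fun n w => passage_time (fun e => sided X (fun=> b) e w) (0, 0)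
      (scale_vertex n e2) / n%:R) (mu b).
    by case: (b) hZ => hZ; [exact: tcm|exact: tcp].
  by move=> H eps eps0; have := H eps eps0; under eq_fun do under eq_set do rewrite scale.
have le_mu b : mubar <= mu b := speed_half_plane mX X0 indX lawX F0 F4 speedX (speedZ b).
have mubar_le : mubar <= Num.min mum mup by rewrite le_min (le_mu true) (le_mu false).
split=> // Fmp; apply/le_anti; rewrite mubar_le/=.
(* [b] is the side carrying the more variable law; its time constant is then a lower bound for
   [mubar]. *)
have [b Fb] : exists b, more_variable (F b) (F (~~ b)).
  by case: Fmp => h; [exists true|exists false].
apply: le_trans (speed_more_variable mX X0 indX lawX Fb speedX (speedZ b)).
by rewrite ge_min; case: (b); rewrite lexx ?orbT.
Qed.
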